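(* There exists a constant $\delta > 0$ such that $$R(k,\ell) \le e^{-\delta \ell + o(k)} \binom{k + \ell}{\ell}$$ for all $k,\ell \in \mathbb{N}$ with $\ell \le k$.
   Context: The Ramsey number $R(k,\ell)$ is the minimum $n \in \mathbb{N}$ such that every red-blue colouring of the edges of the complete graph $K_n$ contains either a red copy of $K_k$ or a blue copy of $K_\ell$. The term $o(k)$ denotes a function of $k$ only (uniform over all admissible $\ell$) which, divided by $k$, tends to $0$ as $k \to \infty$. *)

(* Defs.v *)
From mathcomp Require Import all_boot.

Set Implicit Arguments.
Unset Strict Implicit.
Unset Printing Implicit Defensive.

Definition edge (n : nat) := {e : {set 'I_n} | #|e| == 2}.

Definition coloring (n : nat) := {ffun edge n -> bool}.
Definition red : bool := true.
Definition blue : bool := false.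

Definition mono_clique (n : nat) (c : coloring n) (b : bool) (k : nat)
    (A : {set 'I_n}) : bool :=
  (#|A| == k) && [forall e : edge n, (val e \subset A) ==> (c e == b)].

Definition ramsey_prop (k l n : nat) : bool :=
  [forall c : coloring n,
    [exists A : {set 'I_n}, mono_clique c red k A] ||
    [exists A : {set 'I_n}, mono_clique c blue l A]].

Lemma ramsey_rel (k l : nat) : exists n : nat,
  forall (T : finType) (r : T -> T -> bool), symmetric r ->
  forall V : {set T}, n <= #|V| ->
  (exists A : {set T}, [/\ A \subset V, #|A| = k &
     {in A &, forall x y, x != y -> r x y}]) \/
  (exists A : {set T}, [/\ A \subset V, #|A| = l &
     {in A &, forall x y, x != y -> ~~ r x y}]).
Proof.
have ext (T : finType) (v : T) (V W A : {set T}) (m : nat) (s : T -> T -> bool) :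
    symmetric s -> v \in V -> W \subset V -> v \notin W ->
    {in W, forall x, s v x} -> A \subset W -> #|A| = m ->
    {in A &, forall x y, x != y -> s x y} ->
  exists B : {set T}, [/\ B \subset V, #|B| = m.+1 &
     {in B &, forall x y, x != y -> s x y}].
  move=> ssym vV WV vW sv AW Am sA; exists (v |: A); split.
  - by rewrite subUset sub1set vV (subset_trans AW WV).
  - by rewrite cardsU1 Am (contra (subsetP AW v) vW).
  - move=> x y /setU1P[->|xA] /setU1P[->|yA] xy; first by rewrite eqxx in xy.
    + exact/sv/(subsetP AW).
    + by rewrite ssym; exact/sv/(subsetP AW).
    + exact: sA.
elim: k l => [|k IHk] l.
  exists 0 => T r _ V _; left; exists set0.
  by rewrite sub0set cards0; split => // x y; rewrite inE.
elim: l => [|l [q IHl]].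
  exists 0 => T r _ V _; right; exists set0.
  by rewrite sub0set cards0; split => // x y; rewrite inE.
have [p {}IHk] := IHk l.+1.
exists (p + q).+1 => T r rsym V leV.
have /card_gt0P[v vV] : 0 < #|V| by exact: leq_trans leV.
pose W1 := [set x in V :\ v | r v x]; pose W2 := [set x in V :\ v | ~~ r v x].
have WV1 : W1 \subset V by apply/subsetP => x; rewrite !inE => /andP[/andP[]].
have WV2 : W2 \subset V by apply/subsetP => x; rewrite !inE => /andP[/andP[]].
have vW1 : v \notin W1 by rewrite !inE eqxx.
have vW2 : v \notin W2 by rewrite !inE eqxx.
have rW1 : {in W1, forall x, r v x} by move=> x; rewrite !inE => /andP[].
have rW2 : {in W2, forall x, ~~ r v x} by move=> x; rewrite !inE => /andP[].
have W12 : #|W1| + #|W2| = #|V :\ v|.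
  rewrite -(cardsID [set x | r v x] (V :\ v)).
  by congr (_ + _); apply: eq_card => x; rewrite !inE // andbC.
have VE : #|V| = #|V :\ v|.+1 by rewrite (cardsD1 v) vV.
have [leW|ltW] := leqP p #|W1|.
  have [[A [AW Ak rA]]|[A [AW Al rA]]] := IHk T r rsym W1 leW.
    by left; exact: ext rsym vV WV1 vW1 rW1 AW Ak rA.
  by right; exists A; split => //; exact: subset_trans WV1.
have leW : q <= #|W2|.
  rewrite leqNgt; apply/negP => ltW2; move: leV.
  by rewrite VE -W12 ltnS leqNgt -addSn leq_add // ltnW.
have [[A [AW Ak rA]]|[A [AW Al rA]]] := IHl T r rsym W2 leW.
  by left; exists A; split => //; exact: subset_trans WV2.
right; apply: (ext T v V W2 A l (fun x y => ~~ r x y)) => // x y.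
by rewrite rsym.
Qed.

Lemma ramsey_exists (k l : nat) : exists n, ramsey_prop k l n.
Proof.
have [n H] := ramsey_rel k l; exists n; apply/forallP => c.
pose r (x y : 'I_n) : bool :=
  if insub [set x; y] is Some e then c e else true.
have rsym : symmetric r by move=> x y; rewrite /r setUC.
have rE (e : edge n) : exists x y, [/\ x != y, x \in val e, y \in val e & c e = r x y].
  have /cards2P[x [y [xy eE]]] := valP e.
  exists x, y; rewrite eE !inE !eqxx orbT; split => //.
  by rewrite /r -eE valK.
have := H _ r rsym [set: 'I_n]; rewrite cardsT card_ord leqnn.
case=> // -[A [_ Ak rA]]; apply/orP; [left|right]; apply/existsP; exists A;
  rewrite /mono_clique Ak eqxx; apply/forallP => e; apply/implyP => /subsetP eA;
  have [x [y [xy xe ye ->]]] := rE e.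
  by rewrite rA // eA.
by rewrite eqbF_neg rA // eA.
Qed.

Definition ramsey (k l : nat) : nat := ex_minn (ramsey_exists k l).

(* Main.v *)
Require Import Defs.
From mathcomp Require Import all_boot all_order all_algebra.
From mathcomp Require Import all_classical all_reals all_analysis.
From mathcomp Require Import ring lra zify.
From mathcomp Require Import fintype finset.

(** Let V be a set of vertices without a red clique of size k and without a blue
    clique of size l.  The Erdos-Szekeres argument gives #|V| < 'C(k + l, l), and
    it loses a factor that is exponential in l.  Two mechanisms recover such a
    factor, depending on the ratio l / k; a bound with delta uniform in l / k is
    obtained because each of them works on a fixed range of ratios.

    Far from the diagonal, 100 l <= k ([off_diagonal]).  Put q = l / (k + l).  By
    induction on l every vertex has blue degree at most (q / rho) #|V| for a
    constant rho slightly below 1, hence the red density exceeds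
    p = 1 - q / rho' for a slightly smaller rho'.  A surplus of red edges between
    X and Y over the density p is stable: by Cauchy-Schwarz some v in X satisfies
    that the surplus per vertex of Y does not decrease when Y is replaced by its
    red neighbourhood of v, and that surplus is then shared between the red and
    the blue neighbours of v in X.  As in Pascal's triangle, a surplus of
    'C(a + b, a) - 1 per vertex of Y forces a blue clique of size b in X or a red
    clique of size a in X completely joined in red to at least a fraction
    p ^+ (a + b) of Y ([red_book]).  Take b = l and a = k / 2.  The requirement on X
    is cheap, because 'C(k / 2 + l, l) is about 2 ^ (- l) times 'C(k + l, l).  The
    set Y shrinks by about expR (- l / 2), while the bound for the pair
    (k / 2, l), which it has to exceed, is smaller by 2 ^ (- l) < expR (- l / 2).

    Near the diagonal, l <= k < 100 l, both colours are treated alike.  If the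
    bound to be proved holds for smaller pairs but fails for V, then every vertex
    has colour-b degree close to p_b #|V|, where p_b is the natural density s_b / S
    (s_b the forbidden clique size, S = k + l).  Look for a monochromatic book: a
    clique A of size t in colour b, joined in colour b to a set Z.  The set Z has
    no colour-b clique of size s_b - t, and the Erdos-Szekeres bound for that
    situation is p_b ^+ t 'C(k + l, l) times a factor expR (- const * t ^ 2 / k)
    ([bin_ratio_exp]).  So a book with Z nearly as large as p_b ^+ t #|V| gives a
    contradiction as soon as t is a constant fraction of k.

    Such books come from [monochromatic_book].  It maintains a reservoir X and
    sets Y_red, Y_blue so that each vertex of X has many colour-b neighbours in
    Y_b.  For a random pair of vertices of X the two centred correlations of
    neighbourhoods are Gram kernels, and two Gram kernels cannot both be very
    negative most of the time ([gram_overlap]).  Hence there is a vertex x after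
    which the densities hardly drop, or else the density in one colour jumps by an
    amount proportional to j ^ 2 at the price of a factor of only expR (- 6 j) in
    X ([density_step]).  The quadratic gain for a linear price is decisive: with
    J = N ^ 2 as the threshold for j, the reservoir pays about expR (- 15 J) per
    vertex of A, so t is of order k / J and the gain in the exponent is of order
    t / J, whereas the relative drop of the densities costs only t (log J) / J ^ 2. *)

Set Implicit Arguments.
Unset Strict Implicit.
Unset Printing Implicit Defensive.

Import Order.TTheory GRing.Theory Num.Theory.
Import numFieldNormedType.Exports.

Local Open Scope ring_scope.

(** * Two-colourings of the edges, cliques and books *)

Section Colouring.
Variables (T : finType) (c : T -> T -> bool).
Hypothesis csym : symmetric c.

Definition nbr (b : bool) (x : T) : {set T} := [set y | (y != x) && (c x y == b)].

Definition monochromatic (b : bool) (A : {set T}) : Prop :=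
  {in A &, forall x y, x != y -> c x y = b}.

Definition cliquefree (s : bool -> nat) (V : {set T}) : Prop :=
  forall b (A : {set T}), A \subset V -> monochromatic b A -> (#|A| < s b)%N.

(** The clique sizes that remain to be forbidden inside the common colour-[b]
    neighbourhood of a colour-[b] clique of size [t]. *)
Definition shrink (s : bool -> nat) (b : bool) (t : nat) : bool -> nat :=
  fun b' => if b' == b then (s b' - t)%N else s b'.

Lemma monochromaticU b (A Y : {set T}) :
  monochromatic b A -> monochromatic b Y ->
  (forall x, x \in A -> Y \subset nbr b x) -> monochromatic b (A :|: Y).
Proof.
move=> mA mY AY; have AYc x y : x \in A -> y \in Y -> c x y = b.
  by move=> /AY /subsetP YN /YN; rewrite inE => /andP[_ /eqP].
move=> x y /setUP[xA|xY] /setUP[yA|yY] xy; first exact: mA.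
- exact: AYc.
- by rewrite csym; exact: AYc.
- exact: mY.
Qed.

Lemma book_disjoint b (A Y : {set T}) :
  (forall x, x \in A -> Y \subset nbr b x) -> [disjoint A & Y].
Proof.
move=> AY; apply/pred0P => x /=; apply/negP => /andP[xA xY].
by have := subsetP (AY _ xA) _ xY; rewrite inE eqxx.
Qed.

(** A clique of colour [b] found in [Y] extends [A]; all uses of a book rest on this. *)
Lemma cliquefree_book s V b (A Y : {set T}) : cliquefree s V ->
  A \subset V -> Y \subset V -> monochromatic b A ->
  (forall x, x \in A -> Y \subset nbr b x) ->
  cliquefree (shrink s b #|A|) Y.
Proof.
move=> sV AV YV mA AY b' B BY mB; rewrite /shrink; case: eqP => [b'b|_]; last first.
  by apply: (sV b' B) => //; exact: subset_trans YV.
rewrite b'b ltn_subRL; have AB x : x \in A -> B \subset nbr b x.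
  by move=> /AY; exact: subset_trans.
have <- : #|A :|: B| = (#|A| + #|B|)%N.
  by rewrite cardsU (disjoint_setI0 (book_disjoint AB)) cards0 subn0.
apply: sV; first by rewrite subUset AV (subset_trans BY YV).
by apply: monochromaticU => //; rewrite -b'b.
Qed.

Lemma cliquefree_nbr s V b x : cliquefree s V -> x \in V ->
  cliquefree (shrink s b 1) (V :&: nbr b x).
Proof.
move=> sV xV; rewrite -(cards1 x); apply: (cliquefree_book sV).
- by rewrite sub1set.
- exact: subsetIl.
- by move=> y z /set1P-> /set1P->; rewrite eqxx.
- by move=> y /set1P->; exact: subsetIr.
Qed.

Lemma cliquefree_gt0 s V b x : cliquefree s V -> x \in V -> (0 < s b)%N.
Proof.
move=> sV xV; have := sV b [set x]; rewrite cards1 sub1set xV => /(_ isT) H.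
by apply: ltn_trans (H _) => // y z /set1P-> /set1P->; rewrite eqxx.
Qed.

Lemma card_nbr_split (V : {set T}) x b : x \in V ->
  #|V| = (#|V :&: nbr b x| + #|V :&: nbr (~~ b) x|).+1.
Proof.
move=> xV; rewrite (cardsD1 x) xV add1n; congr _.+1.
rewrite -(cardsID (nbr b x) (V :\ x)).
by congr addn; apply: eq_card => y; rewrite !inE; case: (y == x); case: (y \in V);
  case: (c x y); case: b.
Qed.

Lemma erdos_szekeres s V : cliquefree s V ->
  (#|V| < 'C(s true + s false, s false))%N.
Proof.
have [n] := ubnP (s true + s false)%N; elim: n s V => // n IHn s V.
rewrite ltnS => sn sV; have [->|[x xV]] := set_0Vmem V.
  by rewrite cards0 bin_gt0 leq_addl.
have s1 := cliquefree_gt0 true sV xV; have s0 := cliquefree_gt0 false sV xV.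
have := IHn _ _ _ (cliquefree_nbr (b := true) sV xV).
have := IHn _ _ _ (cliquefree_nbr (b := false) sV xV).
rewrite (card_nbr_split true xV) /shrink /=.
case: (s true) (s false) s1 s0 sn => // k [//|l] _ _ sn.
rewrite !subn1 /= => H1 H2.
have {}H1 := H1 ltac:(lia); have {}H2 := H2 ltac:(lia).
rewrite addSn addnS binS; move: H1 H2; rewrite addSn addnS; lia.
Qed.

End Colouring.

(** * Red books from an excess of red edges *)

Section RedBook.
Variables (R : realFieldType) (T : finType) (c : T -> T -> bool).
Hypothesis csym : symmetric c.
Variable p : R.
Hypothesis p01 : 0 < p <= 1.

Definition red_edge (x y : T) : R := (y \in nbr c true x)%:R.

(** Surplus of red edges between [X] and [Y] over the density [p].  The sets need
    not be disjoint: [red_edge x x] is 0. *)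
Definition excess (X Y : {set T}) : R :=
  \sum_(x in X) \sum_(y in Y) (red_edge x y - p).

Lemma card_red_nbr (Y : {set T}) x :
  #|Y :&: nbr c true x|%:R = \sum_(y in Y) red_edge x y.
Proof.
rewrite -sum1_card natr_sum big_mkcond [RHS]big_mkcond /=; apply: eq_bigr => y _.
by rewrite inE /red_edge; case: (y \in Y); case: (y \in _).
Qed.

Lemma excess_deg (X Y : {set T}) :
  excess X Y = \sum_(x in X) (#|Y :&: nbr c true x|%:R - p * #|Y|%:R).
Proof.
apply: eq_bigr => x _.
by rewrite sumrB -card_red_nbr sumr_const mulr_natr.
Qed.

Lemma excess_nbr (X Y : {set T}) v : excess X (Y :&: nbr c true v) =
  \sum_(y in Y) red_edge v y * \sum_(x in X) (red_edge x y - p).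
Proof.
rewrite /excess exchange_big /= big_mkcond [RHS]big_mkcond /=; apply: eq_bigr => y _.
by rewrite inE {2}/red_edge; case: (y \in Y); case: (y \in _); rewrite /= ?mul1r ?mul0r.
Qed.

(** The sum of both sides over v in X is a sum over y in Y of a function of the red
    degree D y, and the difference equals the variance of D.  So the average
    choice of v is good enough. *)
Lemma excess_variance (X Y : {set T}) : 0 < excess X Y ->
  exists2 v, v \in X &
    excess X Y * #|Y :&: nbr c true v|%:R <= excess X (Y :&: nbr c true v) * #|Y|%:R.
Proof.
move=> f0; set f := excess X Y.
apply/exists_inP; apply: contraLR f0 => /exists_inPn noV.
have [->|[x0 x0X]] := set_0Vmem X; first by rewrite /excess big_set0 ltxx.
suff: \sum_(v in X) f * #|Y :&: nbr c true v|%:R <=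
      \sum_(v in X) excess X (Y :&: nbr c true v) * #|Y|%:R.
  rewrite leNgt => /negP []; apply: ltr_sum => [|v vX]; last by rewrite ltNge noV.
  by apply/hasP; exists x0 => //; rewrite mem_index_enum.
pose D y := \sum_(x in X) red_edge x y.
have E1 : \sum_(v in X) #|Y :&: nbr c true v|%:R = \sum_(y in Y) D y.
  by rewrite exchange_big; apply: eq_bigr => v _; rewrite card_red_nbr.
have DE y : \sum_(x in X) (red_edge x y - p) = D y - p * #|X|%:R.
  by rewrite sumrB sumr_const mulr_natr.
have E2 : \sum_(v in X) excess X (Y :&: nbr c true v) =
    \sum_(y in Y) D y * (D y - p * #|X|%:R).
  under eq_bigr do rewrite excess_nbr.
  rewrite exchange_big; apply: eq_bigr => y _ /=.
  by rewrite -mulr_suml DE.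
have fE : f = \sum_(y in Y) (D y - p * #|X|%:R).
  by rewrite /f /excess exchange_big; apply: eq_bigr => y _; rewrite DE.
rewrite -mulr_sumr -mulr_suml E1 E2.
have [->|[y0 y0Y]] := set_0Vmem Y; first by rewrite !big_set0 mulr0 mul0r.
set n : R := #|Y|%:R.
have n0 : 0 < n by rewrite ltr0n; apply/card_gt0P; exists y0.
set q := p * #|X|%:R in fE *.
have nE z : z * n = \sum_(y in Y) z by rewrite sumr_const mulr_natr.
have q0 : f / n * n = f by rewrite divfK // gt_eqF.
suff H : f / n * \sum_(y in Y) D y <= \sum_(y in Y) D y * (D y - q).
  by rewrite -{1}q0 mulrAC ler_pM2r.
rewrite -subr_ge0 mulr_sumr -sumrB.
rewrite (_ : \sum_(y in Y) _ = \sum_(y in Y) (D y - (f / n + q)) ^+ 2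
      + (f / n + q) * \sum_(y in Y) (D y - q - f / n)).
  rewrite sumrB -fE -nE q0 subrr mulr0 addr0.
  by apply: sumr_ge0 => y _; exact: sqr_ge0.
rewrite mulr_sumr -big_split /=; apply: eq_bigr => y _; ring.
Qed.

Lemma excess_split (X Y : {set T}) v : v \in X -> Y \subset nbr c true v ->
  excess X Y <= #|Y|%:R + excess (X :&: nbr c true v) Y + excess (X :&: nbr c false v) Y.
Proof.
move=> vX YN; rewrite {1}/excess (bigD1 v) //= -addrA; apply: lerD.
  rewrite -sum1_card natr_sum; apply: ler_sum => y yY.
  have -> : red_edge v y = 1 by rewrite /red_edge (subsetP YN).
  by case/andP: p01; lra.
rewrite (bigID [pred x | c v x]) /= /excess lerD //.
  rewrite (eq_bigl (fun x => x \in X :&: nbr c true v)) // => x.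
  by rewrite !inE; case: (c v x); rewrite /= ?andbT ?andbF.
rewrite (eq_bigl (fun x => x \in X :&: nbr c false v)) // => x.
by rewrite !inE; case: (c v x); rewrite /= ?andbT ?andbF.
Qed.

(** Vertices of [X] with fewer than [p * #|Y|] red neighbours in [Y] contribute
    negatively to the excess, so they can be discarded first; afterwards every
    step keeps a fraction [p] of [Y].  The excess per vertex of [Y] that the
    good vertex keeps is at least 'C(a + b, a) - 1, the vertex itself takes at
    most 1 of it, and 'C(a + b, a) - 2 is the sum of the two amounts
    required by the two possible continuations. *)
Lemma red_book a b (X Y : {set T}) : Y != set0 ->
  ('C(a + b, a)%:R - 1) * #|Y|%:R <= excess X Y ->
  (exists B : {set T}, [/\ B \subset X, #|B| = b & monochromatic c false B]) \/
  (exists A Y' : {set T}, [/\ A \subset X, #|A| = a & monochromatic c true A] /\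
    [/\ Y' \subset Y, forall x, x \in A -> Y' \subset nbr c true x &
        p ^+ (a + b) * #|Y|%:R <= #|Y'|%:R]).
Proof.
have [p0 p1] := andP p01.
elim: a b X Y => [|a IHa] b X Y Y0 fXY.
  right; exists set0, Y; rewrite sub0set cards0 subxx; do 2![split=> //].
  - by move=> x y; rewrite inE.
  - by move=> x; rewrite inE.
  - by rewrite ler_piMl // exprn_ile1 // ltW.
elim: b X Y Y0 fXY => [|b IHb] X Y Y0 fXY.
  by left; exists set0; rewrite sub0set cards0; split=> // x y; rewrite inE.
(* Discarding the vertices of low red degree can only raise the excess. *)
pose X0 := [set x in X | p * #|Y|%:R <= #|Y :&: nbr c true x|%:R].
have X0X : X0 \subset X by apply/subsetP => x; rewrite inE => /andP[].
have Yn : 0 < #|Y|%:R :> R by rewrite ltr0n card_gt0.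
have fX0 : excess X Y <= excess X0 Y.
  rewrite !excess_deg (bigID (mem X0)) /= -[leRHS]addr0; apply: lerD.
    rewrite le_eqVlt; apply/orP; left; apply/eqP; apply: eq_bigl => x.
    by rewrite !inE; case: (x \in X).
  apply: sumr_le0 => x; rewrite inE => /andP[->] /=; rewrite -ltNge => /ltW.
  by rewrite subr_le0.
have binE : 'C(a.+1 + b.+1, a.+1)%:R = 'C(a + b.+1, a)%:R + 'C(a.+1 + b, a.+1)%:R :> R.
  by rewrite addSn binS natrD addrC addSnnS.
have bin1 n m : (m <= n)%N -> 1 <= 'C(n, m)%:R :> R by rewrite ler1n bin_gt0.
have B1 := bin1 (a + b.+1)%N a (leq_addr _ _).
have B2 := bin1 (a.+1 + b)%N a.+1 (leq_addr _ _).
have f0 : 0 < excess X0 Y.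
  apply: lt_le_trans fX0; apply: lt_le_trans fXY; apply: mulr_gt0 => //.
  by rewrite binE; lra.
have [v vX0 fv] := excess_variance f0.
set Yv := Y :&: _ in fv.
have YvN : Yv \subset nbr c true v by exact: subsetIr.
have pYv : p * #|Y|%:R <= #|Yv|%:R by move: vX0; rewrite inE => /andP[].
have Yv0 : 0 < #|Yv|%:R :> R by apply: lt_le_trans pYv; exact: mulr_gt0.
have Yvn0 : Yv != set0 by rewrite -card_gt0 -(ltr0n R).
have {fv} : ('C(a.+1 + b.+1, a.+1)%:R - 1) * #|Yv|%:R <= excess X0 Yv.
  rewrite -(ler_pM2r Yn); apply: le_trans fv; rewrite mulrAC ler_pM2r //.
  exact: le_trans fX0.
move/le_trans/(_ (excess_split vX0 YvN)); rewrite binE => fs.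
have vX := subsetP X0X _ vX0.
have XX0 d : X0 :&: nbr c d v \subset X by rewrite subIset // X0X.
have powS m : p ^+ m * #|Yv|%:R >= p ^+ m.+1 * #|Y|%:R.
  by rewrite exprSr -mulrA ler_wpM2l // exprn_ge0 // ltW.
have [fR|fR] := lerP (('C(a + b.+1, a)%:R - 1) * #|Yv|%:R)
                     (excess (X0 :&: nbr c true v) Yv).
  have [[B [BX Bb mB]]|[A [Y' [[AX Aa mA] [YY AY pY]]]]] := IHa _ _ _ Yvn0 fR.
    by left; exists B; split=> //; exact: subset_trans (XX0 true).
  right; exists (v |: A), Y'; have vA : v \notin A.
    by apply/negP => /(subsetP AX); rewrite !inE eqxx andbF.
  split; split.
  - by rewrite subUset sub1set vX (subset_trans AX).
  - by rewrite cardsU1 vA Aa.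
  - apply: monochromaticU => //; first by move=> x y /set1P-> /set1P->; rewrite eqxx.
    by move=> x /set1P->; rewrite (subset_trans AX) // subsetIr.
  - by rewrite (subset_trans YY) // subsetIl.
  - by move=> x /setU1P[->|/AY//]; exact: subset_trans YvN.
  - by apply: le_trans pY; rewrite addSn.
have {}fs : ('C(a.+1 + b, a.+1)%:R - 1) * #|Yv|%:R <= excess (X0 :&: nbr c false v) Yv.
  by lra.
have [[B [BX Bb mB]]|[A [Y' [[AX Aa mA] [YY AY pY]]]]] := IHb _ _ Yvn0 fs.
  left; exists (v |: B); have vB : v \notin B.
    by apply/negP => /(subsetP BX); rewrite !inE eqxx andbF.
  split.
  - by rewrite subUset sub1set vX (subset_trans BX).
  - by rewrite cardsU1 vB Bb.
  - apply: monochromaticU => //; first by move=> x y /set1P-> /set1P->; rewrite eqxx.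
    by move=> x /set1P->; rewrite (subset_trans BX) // subsetIr.
right; exists A, Y'; split; split=> //.
- exact: subset_trans (XX0 false).
- by rewrite (subset_trans YY) // subsetIl.
- by apply: le_trans pY; rewrite addnS.
Qed.

End RedBook.

(** * Binomial ratios and the bound far from the diagonal *)

(** Each of the [l] factors (m + i) / (n + i) of the quotient of the binomials is at
    most the last one, (m + l) / (n + l). *)
Lemma ler_bin_ratio (R : realFieldType) (r : R) (m n l : nat) : 0 <= r <= 1 ->
  (m + l)%:R <= r * (n + l)%:R ->
  'C(m + l, l)%:R <= r ^+ l * 'C(n + l, l)%:R.
Proof.
move=> /andP[r0 r1]; elim: l => [|l IHl] H; first by rewrite !bin0 expr0 mul1r.
have {}IHl : 'C(m + l, l)%:R <= r ^+ l * 'C(n + l, l)%:R.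
  by apply: IHl; move: H; rewrite !addnS -2!natr1; lra.
have D a : l.+1%:R * 'C(a + l.+1, l.+1)%:R = (a + l.+1)%:R * 'C(a + l, l)%:R :> R.
  by rewrite addnS -!natrM mul_bin_diag.
rewrite -(ler_pM2l (ltr0Sn R l)) mulrCA !D exprSr.
apply: le_trans (ler_wpM2l (ler0n _ _) IHl) _.
rewrite -[leRHS]mulrA ![_ * (r ^+ l * _)]mulrCA ler_wpM2l ?exprn_ge0 //.
by rewrite mulrA ler_wpM2r // ler0n.
Qed.

(** The left side is what [l] halvings cost with some room to spare; the right side
    is the fraction of [Y] that survives about k / 2 + l steps at density 1 - x.
    To first order the right side is expR (- x * (k / 2 + l)), close to
    expR (- 0.51 * l). *)
Lemma exp_half_bound (R : realType) (k l t : nat) (x : R) :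
  (0 < l)%N -> (100 * l <= k)%N -> (t.*2 <= k.+1)%N ->
  x = l%:R / (k + l)%:R / (98 / 100) ->
  (56 / 100) ^+ l <= (1 - x) ^+ (t + l).
Proof.
move=> l0 lk tk xE.
have l1 : 1 <= l%:R :> R by rewrite ler1n.
have kl : 100 * l%:R <= k%:R :> R by rewrite -[100]/(100%:R) -natrM ler_nat.
have tR : 2 * t%:R <= k%:R + 1 :> R by rewrite natr1 -[2]/(2%:R) -natrM ler_nat mul2n.
have S0 : 0 < (k + l)%:R :> R by rewrite natrD; lra.
have xS : x * (98 / 100) * (k%:R + l%:R) = l%:R by rewrite xE -natrD; field; apply/eqP; lra.
have x0 : 0 <= x by rewrite xE !mulr_ge0 ?invr_ge0 ?ler0n //; lra.
have x1 : x <= 2 / 100.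
  rewrite leNgt; apply/negP => x1; move: xS; set S := k%:R + l%:R => xS.
  have S1 : 101 * l%:R <= S by rewrite /S; lra.
  have : 2 / 100 * (98 / 100 * S) < x * (98 / 100 * S) by rewrite ltr_pM2r //; lra.
  by lra.
have y0 : 0 < 1 - x by lra.
have eb : (1 - x)^-1 ^+ (t + l) <= expR (55 / 100 * l%:R).
  have -> : (1 - x)^-1 = 1 + x / (1 - x) by field; apply/eqP; lra.
  apply: le_trans (_ : expR (x / (1 - x)) ^+ (t + l) <= _).
    apply: lerXn2r; rewrite ?nnegrE ?expR_ge0 ?expR_ge1Dx //.
    by rewrite addr_ge0 // divr_ge0 // ltW.
  rewrite -expRM_natr ler_expR.
  rewrite -mulrA mulrCA ler_pdivrMl // natrD.
  apply: le_trans (_ : 98 / 100 * (55 / 100 * l%:R) <= _).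
    rewrite -[X in _ <= _ * (_ * X)]xS.
    have : 0 <= x * ((98/100) * (55/100) * (98/100) * (k%:R + l%:R) - (t%:R + l%:R)).
      by apply: mulr_ge0 => //; lra.
    lra.
  by apply: ler_wpM2r; lra.
have ec : expR (55 / 100 * l%:R) <= (56 / 100)^-1 ^+ l :> R.
  rewrite expRM_natr; apply: lerXn2r; rewrite ?nnegrE ?expR_ge0 ?invr_ge0 //.
  have small n : expR (n%:R / 20) <= (19 / 20)^-1 ^+ n :> R.
    rewrite [n%:R / 20]mulrC expRM_natr; apply: lerXn2r; rewrite ?nnegrE ?expR_ge0 ?invr_ge0 //.
    rewrite -[leLHS]invrK lef_pV2 ?posrE ?invr_gt0 ?expR_gt0 //.
    by rewrite -expRN; apply: le_trans (expR_ge1Dx _); lra.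
  have -> : 55 / 100 = 11%:R / 20 :> R by lra.
  apply: le_trans (small 11%N) _.
  by rewrite exprVn lef_pV2 ?posrE; lra.
have := le_trans eb ec.
by rewrite !exprVn lef_pV2 // posrE exprn_gt0 //; lra.
Qed.

(** The linear factor absorbs the gap between the two densities 1 - q / (99 / 100)
    and 1 - q / (98 / 100): the excess per vertex is the product of #|V|
    and this gap, of order l / (k + l). *)
Lemma off_diagonal (R : realType) (T : finType) (c : T -> T -> bool)
    (s : bool -> nat) (V : {set T}) : symmetric c ->
  (100 * s false <= s true)%N -> cliquefree c s V ->
  #|V|%:R < 100 * (s true + s false).+1%:R * (99 / 100) ^+ s false *
            'C(s true + s false, s false)%:R :> R.
Proof.
move=> csym; move kE : (s true) => k; move lE : (s false) => l.
elim: l s V kE lE => [|l IHl] s V kE lE lk sV.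
  have [->|[x xV]] := set_0Vmem V.
    by rewrite cards0 expr0 mulr1 !mulr_gt0 // ltr0n bin_gt0 leq_addl.
  by have := cliquefree_gt0 false sV xV; rewrite lE.
have [//|GV] := ltrP.
set rho : R := 99 / 100 in IHl GV.
have [l1 k1] : (1 <= l.+1%:R :> R) /\ (100 * l.+1%:R <= k%:R :> R).
  by rewrite ler1n -[100]/(100%:R) -natrM ler_nat.
set n : R := #|V|%:R in GV.
set S : R := (k + l.+1)%:R in GV.
have S1 : (k + l.+1).+1%:R = S + 1 :> R by rewrite -natr1.
rewrite S1 in GV.
have SE : S = k%:R + l.+1%:R by rewrite /S natrD.
set B : R := 'C(k + l.+1, l.+1)%:R in GV.
have B0 : 0 < B by rewrite ltr0n bin_gt0 leq_addl.
have rho0 : 0 < rho by rewrite /rho; lra.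
have r0 m : 0 < rho ^+ m by exact: exprn_gt0.
set q : R := l.+1%:R / S.
have qS : q * S = l.+1%:R by rewrite divfK // gt_eqF // SE; lra.
have q0 : 0 < q by rewrite divr_gt0 //; lra.
have Vn : n * (q / rho) >= 100 * (k + l).+1%:R * rho ^+ l * 'C(k + l, l)%:R.
  have -> : 'C(k + l, l)%:R = q * B.
    apply: (mulfI (_ : S != 0)); first by rewrite gt_eqF // SE; lra.
    by rewrite mulrA [S * q]mulrC qS /S /B addnS -!natrM mul_bin_diag.
  apply: le_trans (ler_wpM2r (_ : 0 <= q / rho) GV); last first.
    by rewrite divr_ge0 // ltW.
  have -> : 100 * (S + 1) * rho ^+ l.+1 * B * (q / rho) = 100 * (S + 1) * rho ^+ l * (q * B).
    by rewrite exprSr; field; rewrite gt_eqF.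
  apply: ler_wpM2r; first by rewrite mulr_ge0 // ltW.
  apply: ler_wpM2r; first exact: ltW.
  have : (k + l).+1%:R <= S + 1 by rewrite -S1 ler_nat addnS.
  by lra.
have degB x : x \in V -> #|V :&: nbr c false x|%:R <= n * (q / rho).
  move=> xV; apply/ltW; apply: lt_le_trans Vn.
  apply: (IHl (shrink s false 1)); rewrite /shrink /= ?kE ?lE ?subn1 //; first by lia.
  exact: cliquefree_nbr.
pose p : R := 1 - q / (98 / 100).
have qle : q <= 1 / 100 by rewrite -(ler_pM2r (_ : 0 < S)) ?qS SE; lra.
have p01 : 0 < p <= 1 by rewrite /p; apply/andP; split; lra.
(* Half of the red clique is built in X, the other half is found in Y. *)
set t := uphalf k.
have Vne : V != set0.
  rewrite -card_gt0 -(ltr0n R); apply: lt_le_trans GV.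
  by rewrite !mulr_gt0 // SE; lra.
have tk : (t.*2 <= k.+1)%N by rewrite uphalfK; case: (odd k).
have tkR : 2 * t%:R <= k%:R + 1 :> R by rewrite natr1 -[2]/(2%:R) -natrM ler_nat mul2n.
have nq : 'C(t + l.+1, t)%:R <= n * q / 100.
  rewrite -[t in 'C(_, t)](addnK l.+1) bin_sub ?leq_addl //.
  apply: le_trans (ler_bin_ratio (n := k) (r := rho) _ _) _.
  - by rewrite /rho; apply/andP; split; lra.
  - by rewrite !natrD /rho; lra.
  rewrite -/B ler_pdivlMr //.
  apply: le_trans (ler_wpM2r (ltW q0) GV).
  have -> : 100 * (S + 1) * rho ^+ l.+1 * B * q = (rho ^+ l.+1 * B) * 100 * (l.+1%:R + q).
    by rewrite -[in RHS]qS; ring.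
  by rewrite ler_peMr ?mulr_ge0 ?ltW //; lra.
have fV : ('C(t + l.+1, t)%:R - 1) * #|V|%:R <= excess c p V V.
  rewrite excess_deg -/n mulr_natr -sumr_const; apply: ler_sum => x xV.
  have := card_nbr_split c true xV => /(congr1 (fun m => m%:R : R)) /=.
  rewrite -natr1 natrD -/n => nE.
  have := degB _ xV; rewrite /p /rho.
  have : 0 <= n * q by rewrite mulr_ge0 ?ler0n // ltW.
  by move: nq; lra.
have [[A [AV Al mA]]|[A [Y [[AV At mA] [YV AY pY]]]]] := red_book csym p01 Vne fV.
  by have := sV false A AV mA; rewrite Al lE ltnn.
have := erdos_szekeres csym (cliquefree_book csym sV AV YV mA AY).
rewrite /shrink /= kE lE At -(ltr_nat R) ltNge => /negP[].
apply: le_trans pY; rewrite -/n.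
apply: le_trans (ler_bin_ratio (n := k) (r := 52 / 100) _ _) _.
- by apply/andP; split; lra.
- have : (k - t)%:R <= k%:R / 2 :> R.
    have : (2 * (k - t) <= k)%N.
      by rewrite mulnBr leq_subLR !mul2n -{1}addnn leq_add2r uphalfK leq_addl.
    by rewrite -(ler_nat R) natrM; lra.
  by rewrite !natrD; lra.
rewrite -/B.
have xb := exp_half_bound (R := R) (ltn0Sn l) lk tk erefl.
apply: le_trans (_ : (56 / 100) ^+ l.+1 * n <= _); last first.
  by apply: ler_wpM2r => //; exact: ler0n.
apply: le_trans (_ : (56 / 100) ^+ l.+1 * (rho ^+ l.+1 * B) <= _); last first.
  apply: ler_wpM2l; first by apply: exprn_ge0; lra.
  apply: le_trans GV; rewrite -[100 * _ * _ * _]mulrA ler_peMl ?mulr_ge0 ?ltW //.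
  by rewrite SE; lra.
rewrite mulrA -exprMn; apply: ler_wpM2r; first exact: ltW.
by clear; apply: lerXn2r; rewrite ?nnegrE /rho; lra.
Qed.

(** * Gram kernels and Chebyshev polynomials *)

Section Gram.
Variables (R : rcfType) (T : finType).
Implicit Types K L : T -> T -> R.

(** Positive semidefinite kernels, given by explicit finite factorizations.  In this
    form closure under products is immediate. *)
Definition gram K := exists (I : finType) (phi : I -> T -> R),
  forall u v, K u v = \sum_i phi i u * phi i v.

Lemma gram_const a : 0 <= a -> gram (fun _ _ => a).
Proof.
move=> a0; exists unit, (fun _ _ => Num.sqrt a) => u v.
by rewrite (big_pred1 tt) -?expr2 ?sqr_sqrtr //; case.
Qed.

Lemma gramD K L : gram K -> gram L -> gram (fun u v => K u v + L u v).
Proof.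
move=> [I [phi KE]] [J [psi LE]].
exists (I + J)%type, (fun i => match i with inl i => phi i | inr j => psi j end) => u v.
by rewrite big_sumType /= KE LE.
Qed.

Lemma gramM K L : gram K -> gram L -> gram (fun u v => K u v * L u v).
Proof.
move=> [I [phi KE]] [J [psi LE]].
exists (I * J)%type, (fun ij u => phi ij.1 u * psi ij.2 u) => u v.
rewrite KE LE big_distrlr /= pair_big /=.
by apply: eq_bigr => -[i j] _ /=; rewrite mulrACA.
Qed.

Lemma gram_sum_ge0 K (X : {set T}) : gram K -> 0 <= \sum_(u in X) \sum_(v in X) K u v.
Proof.
move=> [I [phi KE]].
rewrite (_ : \sum_(u in X) _ = \sum_i (\sum_(u in X) phi i u) ^+ 2).
  by apply: sumr_ge0 => i _; exact: sqr_ge0.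
under eq_bigr do under eq_bigr do rewrite KE.
under eq_bigr do rewrite exchange_big /=.
rewrite exchange_big /=; apply: eq_bigr => i _.
by rewrite expr2 big_distrlr.
Qed.

End Gram.

Section Chebyshev.
Variable R : realType.
Implicit Types x y w : R.

Definition chebyshev_step y (P : R * R) : R * R :=
  (P.1 + (2 * y * P.1 + P.2), 2 * y * P.1 + P.2).

(** First component: the Chebyshev polynomial of degree m + 1 at 1 + y.  Second
    component: its difference with the polynomial of degree m.  Written in y, the
    recurrence has nonnegative coefficients, so it preserves Gram kernels. *)
Definition chebyshev_pair m y : R * R := iter m (chebyshev_step y) (1 + y, y).

Lemma chebyshev_pairS m y :
  chebyshev_pair m.+1 y = chebyshev_step y (chebyshev_pair m y).
Proof. by []. Qed.

(** This is the Pell equation T ^ 2 - (z ^ 2 - 1) U ^ 2 = 1 for z = 1 + y, without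
    the polynomials U of the second kind.  It bounds T on [-1, 1] with no
    trigonometry. *)
Lemma chebyshev_pell m y : let P := chebyshev_pair m y in
  (P.2 + y * P.1) ^+ 2 = (y ^+ 2 + 2 * y) * (P.1 ^+ 2 - 1).
Proof.
elim: m => [|m]; first by rewrite /=; ring.
rewrite chebyshev_pairS; case: (chebyshev_pair m y) => t d /= H.
have -> : (2 * y * t + d + y * (t + (2 * y * t + d))) ^+ 2 =
    (d + y * t) ^+ 2 + (y ^+ 2 + 2 * y) * ((t + (2 * y * t + d)) ^+ 2 - t ^+ 2) by ring.
by rewrite H; ring.
Qed.

Lemma chebyshev_le1 m y : -2 < y <= 0 -> `|(chebyshev_pair m y).1| <= 1.
Proof.
case/andP=> y2; rewrite le_eqVlt => /orP[/eqP->|y0].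
  suff -> : chebyshev_pair m 0 = (1, 0) by rewrite normr1.
  elim: m => [|m IH]; first by rewrite /chebyshev_pair /= addr0.
  by rewrite chebyshev_pairS IH /chebyshev_step /=; congr pair; ring.
have := chebyshev_pell m y; move: (chebyshev_pair m y) => [t d] /= H.
rewrite -(@ler_pXn2r _ 2) ?nnegrE // expr1n real_normK ?num_real //.
have neg : y ^+ 2 + 2 * y < 0 by rewrite expr2 -mulrDl nmulr_llt0 //; lra.
rewrite -subr_le0 -(nmulr_rge0 _ neg) -H; exact: sqr_ge0.
Qed.

Lemma chebyshev_ge m y : 0 <= y -> let P := chebyshev_pair m y in
  0 <= P.2 /\ 1 + m.+1%:R ^+ 2 * y <= P.1.
Proof.
move=> y0 /=; suff: (2 * m%:R + 1) * y <= (chebyshev_pair m y).2 /\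
    1 + m.+1%:R ^+ 2 * y <= (chebyshev_pair m y).1.
  move=> [H H2]; split=> //; apply: le_trans H.
  by rewrite mulr_ge0 // addr_ge0 // mulr_ge0 // ler0n.
elim: m => [|m]; first by rewrite /=; split; lra.
rewrite chebyshev_pairS; case: (chebyshev_pair m y) => t d /= [Hd Ht].
have m0 : 0 <= m%:R :> R by [].
have ty : y <= y * t.
  rewrite ler_peMr //; apply: le_trans Ht.
  by rewrite lerDl mulr_ge0 // sqr_ge0.
move: Hd Ht; rewrite -(natr1 m.+1) -(natr1 m); set M := m%:R => Hd Ht.
by split; lra.
Qed.

(** For w + 1 / w = 2 (1 + y) the polynomial of degree n at 1 + y equals
    (w ^ n + w ^ (- n)) / 2; a larger w gives an upper bound. *)
Lemma chebyshev_upper m y w : 0 <= y -> 1 <= w -> 2 * y * w <= (w - 1) ^+ 2 ->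
  (chebyshev_pair m y).1 <= w ^+ m.+1.
Proof.
move=> y0 w1 hw.
have w0 : 0 < w by lra.
suff: (chebyshev_pair m y).1 <= w ^+ m.+1 /\
    (chebyshev_pair m y).1 <= w * ((chebyshev_pair m y).1 - (chebyshev_pair m y).2).
  by case.
elim: m => [|m].
  have : 1 + y <= w; last by rewrite /= expr1; split; lra.
  rewrite -(ler_pM2r w0); have : 0 <= (w - 1) ^+ 2 by exact: sqr_ge0.
  have : 0 <= (w - 1) * w by rewrite mulr_ge0; lra.
  by rewrite expr2 in hw *; lra.
have [d0 t1] := chebyshev_ge m y0.
rewrite chebyshev_pairS; case: (chebyshev_pair m y) d0 t1 => t d /= d0 t1 [IH1 IH2].
have t0 : 0 <= t by apply: le_trans t1; rewrite addr_ge0 // mulr_ge0 // sqr_ge0.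
suff H : t + (2 * y * t + d) <= w * t.
  split; last by move: H; lra.
  apply: le_trans H _; rewrite exprS; apply: ler_wpM2l => //; exact: ltW.
rewrite -(ler_pM2r w0).
have : 0 <= t * ((w - 1) ^+ 2 - 2 * y * w) by rewrite mulr_ge0 // subr_ge0.
by move: IH2; rewrite expr2; lra.
Qed.

(** A polynomial substitute for cosh (sqrt x), to which it converges as m tends to
    infinity: bounded by 1 for negative x, at least 1 + x / 2 and at most
    expR (3 sqrt x) for positive x, as long as |x| < (2 m + 2) ^ 2. *)
Definition scaled_chebyshev m x : R := (chebyshev_pair m (x / (2 * m.+1%:R ^+ 2))).1.

Lemma gram_scaled_chebyshev (T : finType) (K : T -> T -> R) m : gram K ->
  gram (fun u v => scaled_chebyshev m (K u v)).
Proof.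
move=> gK; pose y u v := K u v / (2 * m.+1%:R ^+ 2); rewrite /scaled_chebyshev.
have gy : gram y.
  apply: gramM gK (gram_const _ _); rewrite invr_ge0 mulr_ge0 // exprn_ge0 //.
suff: gram (fun u v => (chebyshev_pair m (y u v)).1) /\
    gram (fun u v => (chebyshev_pair m (y u v)).2) by case.
have g1 := gram_const T (@ler01 R); have g2 := gram_const T (ler0n R 2).
elim: m {y} (y) gy => [|m IHm] y gy; first by split=> //; exact: gramD.
have [gt gd] := IHm y gy.
have gD := gramD (gramM (gramM g2 gy) gt) gd.
by split=> //; exact: (gramD gt gD).
Qed.

Lemma scaled_chebyshev_le1 m x : - (2 * m.+1%:R) ^+ 2 < x <= 0 ->
  `|scaled_chebyshev m x| <= 1.
Proof.
move=> /andP[x1 x0]; apply: chebyshev_le1.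
have M0 : 0 < 2 * m.+1%:R ^+ 2 :> R by rewrite mulr_gt0 // exprn_gt0 // ltr0n.
rewrite ltr_pdivlMr // pmulr_lle0 ?invr_gt0 // x0 andbT.
by move: x1; rewrite exprMn; lra.
Qed.

Lemma scaled_chebyshev_ge m x : 0 <= x -> 1 + x / 2 <= scaled_chebyshev m x.
Proof.
move=> x0; have M0 : 0 < m.+1%:R :> R by rewrite ltr0n.
have y0 : 0 <= x / (2 * m.+1%:R ^+ 2) by rewrite divr_ge0 // mulr_ge0 // exprn_ge0 // ltW.
apply: le_trans (chebyshev_ge m y0).2; rewrite lerD2l le_eqVlt; apply/orP; left.
by apply/eqP; field; rewrite gt_eqF.
Qed.

Lemma scaled_chebyshev_upper m x : 0 <= x < (2 * m.+1%:R) ^+ 2 ->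
  scaled_chebyshev m x <= expR (3 * Num.sqrt x).
Proof.
move=> /andP[x0 x1]; set M : R := m.+1%:R in x1 *.
have M0 : 0 < M by rewrite ltr0n.
set r := Num.sqrt x; have r0 : 0 <= r by exact: sqrtr_ge0.
have xr : x = r ^+ 2 by rewrite sqr_sqrtr.
have rM : r <= 2 * M.
  by rewrite -(@ler_pXn2r _ 2) ?nnegrE -?xr ?mulr_ge0 //; exact: ltW.
pose s := r / M; have s0 : 0 <= s by rewrite divr_ge0 // ltW.
have yE : x / (2 * M ^+ 2) = s ^+ 2 / 2 by rewrite xr /s; field; rewrite gt_eqF.
have s2 : s <= 2 by rewrite ler_pdivrMr.
rewrite /scaled_chebyshev -/M yE.
apply: le_trans (_ : (1 + (s + s ^+ 2)) ^+ m.+1 <= _).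
  apply: chebyshev_upper; first by rewrite divr_ge0 // sqr_ge0.
    by rewrite lerDl addr_ge0 // sqr_ge0.
  rewrite -subr_ge0 (_ : _ - _ = s ^+ 3) ?exprn_ge0 //; by field.
apply: le_trans (_ : expR (s + s ^+ 2) ^+ m.+1 <= _).
  by apply: lerXn2r; rewrite ?nnegrE ?expR_ge0 ?expR_ge1Dx // !addr_ge0 // sqr_ge0.
rewrite -expRM_natr ler_expR -/M.
have sM : s * M = r by rewrite divfK // gt_eqF.
have : 0 <= s * M * (2 - s) by rewrite mulr_ge0 ?subr_ge0 // sM.
by rewrite -sM; lra.
Qed.

End Chebyshev.

(** * Correlation of two Gram kernels *)

Section Geometry.
Variable R : realType.

(** Any constant below expR (- 5) / 28 would do: the proof of [gram_overlap]
    compares 1 with 28 * expR 5 times this constant. *)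
Definition overlap_const : R := (29 * expR 5)^-1.

Lemma overlap_const_gt0 : 0 < overlap_const.
Proof. by rewrite invr_gt0 mulr_gt0 // expR_gt0. Qed.

(** Has nonnegative average on Gram kernels, is at most - 1 when one of its arguments
    is below - 6, and grows only like the exponential of the square root of
    the larger argument. *)
Definition symmetric_test m (x y : R) : R :=
  x * (2 + scaled_chebyshev m y) + y * (2 + scaled_chebyshev m x).

Lemma symmetric_testC m x y : symmetric_test m x y = symmetric_test m y x.
Proof. by rewrite /symmetric_test addrC. Qed.

(** When x < - 6, the first summand is at most - 6 (3 + y / 2) for positive y, which
    outweighs the second summand, at most 3 y. *)
Lemma symmetric_test_low m x y :
  `|x| < (2 * m.+1%:R) ^+ 2 -> `|y| < (2 * m.+1%:R) ^+ 2 ->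
  x < - 6 -> symmetric_test m x y <= - 1.
Proof.
rewrite !ltr_norml => /andP[xl xu] /andP[yl yu] x6; rewrite /symmetric_test.
have /ler_normlP[Cx1 Cx2] : `|scaled_chebyshev m x| <= 1.
  by apply: scaled_chebyshev_le1; rewrite xl; lra.
have [y0|y0] := lerP y 0.
  have /ler_normlP[Cy1 Cy2] : `|scaled_chebyshev m y| <= 1.
    by apply: scaled_chebyshev_le1; rewrite yl.
  have : 0 <= (- x) * (1 + scaled_chebyshev m y) by rewrite mulr_ge0; lra.
  have : 0 <= (- y) * (2 + scaled_chebyshev m x) by rewrite mulr_ge0; lra.
  by lra.
have Cy := scaled_chebyshev_ge m (ltW y0).
have : 0 <= (- x - 6) * (3 + y / 2) by rewrite mulr_ge0; lra.
have : 0 <= (- x) * (scaled_chebyshev m y - 1 - y / 2) by rewrite mulr_ge0; lra.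
have : 0 <= y * (1 - scaled_chebyshev m x) by rewrite mulr_ge0; lra.
by lra.
Qed.

Lemma symmetric_test_high m x y (s : R) :
  `|x| < (2 * m.+1%:R) ^+ 2 -> `|y| < (2 * m.+1%:R) ^+ 2 -> 0 <= s ->
  - 6 <= x <= s ^+ 2 - 6 -> - 6 <= y <= s ^+ 2 - 6 ->
  symmetric_test m x y <= 6 * expR (5 * s).
Proof.
move=> xb yb s0 xs ys.
have e1 : 1 <= expR (3 * s) by rewrite -[leLHS]expR0 ler_expR; lra.
have s2e : s ^+ 2 <= expR (2 * s).
  have -> : 2 * s = s * 2%:R by lra.
  rewrite expRM_natr; apply: lerXn2r; rewrite ?nnegrE ?expR_ge0 //.
  by apply: le_trans (expR_ge1Dx s); lra.
have Cb z : `|z| < (2 * m.+1%:R) ^+ 2 -> - 6 <= z <= s ^+ 2 - 6 ->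
    0 <= 2 + scaled_chebyshev m z <= 3 * expR (3 * s).
  rewrite ltr_norml => /andP[zl zu] /andP[z6 zs].
  have [z0|z0] := lerP z 0.
    have /ler_normlP[C1 C2] : `|scaled_chebyshev m z| <= 1.
      by apply: scaled_chebyshev_le1; rewrite zl.
    by apply/andP; split; lra.
  have C1 := scaled_chebyshev_ge m (ltW z0).
  have C2 : scaled_chebyshev m z <= expR (3 * Num.sqrt z).
    by apply: scaled_chebyshev_upper; rewrite ltW.
  have C3 : expR (3 * Num.sqrt z) <= expR (3 * s).
    rewrite ler_expR ler_pM2l // -(@ler_pXn2r _ 2) ?nnegrE ?sqrtr_ge0 //.
    by rewrite sqr_sqrtr ?ltW //; lra.
  by apply/andP; split; lra.
have term z t : - 6 <= z <= s ^+ 2 - 6 -> 0 <= t <= 3 * expR (3 * s) ->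
    z * t <= 3 * expR (5 * s).
  move=> /andP[z6 zs] /andP[t0 t1].
  have [z0|z0] := lerP z 0.
    apply: le_trans (_ : 0 <= _); first by rewrite mulr_le0_ge0.
    by rewrite mulr_ge0 ?expR_ge0.
  have -> : 5 * s = 2 * s + 3 * s by lra.
  rewrite expRD mulrCA; apply: ler_pM => //; first exact: ltW.
  by apply: le_trans s2e; lra.
have := term _ _ xs (Cb _ yb ys); have := term _ _ ys (Cb _ xb xs).
rewrite /symmetric_test; lra.
Qed.

Lemma sum_expRN_le2 n : \sum_(i < n) expR (- i%:R : R) <= 2.
Proof.
elim: n => [|n IH]; first by rewrite big_ord0.
have e2 : expR (- 1) <= 2^-1 :> R.
  by rewrite expRN lef_pV2 ?posrE ?expR_gt0 //; apply: le_trans (expR_ge1Dx _); lra.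
rewrite big_ord_recl oppr0 expR0.
under eq_bigr => i _ do rewrite lift0 -natr1 opprD expRD.
rewrite -mulr_suml.
have : (\sum_(i < n) expR (- i%:R : R)) * expR (- 1) <= 2 * 2^-1.
  by apply: ler_pM; rewrite ?expR_ge0 //; apply: sumr_ge0 => i _; exact: expR_ge0.
by lra.
Qed.

(** The average of the test function over pairs is nonnegative, so pairs with an
    entry below - 6, where it is at most - 1, are balanced by pairs on which it is
    positive.  If for all j only few pairs reached j ^ 2 - 6, the subexponential
    growth of the test function would make the positive part too small. *)
Lemma gram_overlap (T : finType) (X : {set T}) (W : bool -> T -> T -> R) :
  X != set0 -> (forall b, gram (W b)) ->
  exists u b (j : nat), u \in X /\
    overlap_const * expR (- (6 * j%:R)) * #|X|%:R <=
    #|[set v in X | (j%:R ^+ 2 - 6 <= W b u v) && (- 6 <= W (~~ b) u v)]|%:R.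
Proof.
move=> X0 gW; set beta := overlap_const.
have beta0 : 0 < beta := overlap_const_gt0.
pose N : R := #|X|%:R; have N0 : 0 < N by rewrite ltr0n card_gt0.
pose hit b (j : nat) u v := (j%:R ^+ 2 - 6 <= W b u v) && (- 6 <= W (~~ b) u v).
have [//|none] := pselect (exists u b (j : nat), u \in X /\
    beta * expR (- (6 * j%:R)) * N <= #|[set v in X | hit b j u v]|%:R).
have {none} few b (j : nat) u : u \in X ->
    \sum_(v in X) (hit b j u v)%:R <= beta * expR (- (6 * j%:R)) * N.
  move=> uX; have [//|lt_hit] := lerP (\sum_(v in X) (hit b j u v)%:R) _.
  case: none; exists u, b, j; split=> //; apply/ltW/(lt_le_trans lt_hit).
  rewrite -sum1_card natr_sum big_mkcond [leRHS]big_mkcond /=; apply: ler_sum => v _.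
  by rewrite inE; case: (v \in X) => //=; case: (hit b j u v).
have [m mW] : exists m : nat, forall b u v, `|W b u v| < (2 * m.+1%:R) ^+ 2.
  (* The degree must be so large that all values of the kernels lie in the range
     where the bounds on the scaled polynomial hold. *)
  pose S := \sum_b \sum_u \sum_v `|W b u v|.
  have S0 : 0 <= S by do 3![apply: sumr_ge0 => ? _].
  exists (Num.truncn S) => b u v.
  have WS : `|W b u v| <= S.
    rewrite /S (bigD1 b) //= (bigD1 u) //= (bigD1 v) //= -!addrA lerDl.
    by rewrite !addr_ge0 //; do ?[apply: sumr_ge0 => ? _ //].
  apply: le_lt_trans WS _; have := truncnS_gt S.
  set M := _%:R => SM; have M1 : 1 <= M by rewrite /M ler1n.
  have : M <= M ^+ 2 by rewrite expr2 ler_peMr //; lra.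
  by rewrite exprMn; lra.
pose f u v := symmetric_test m (W true u v) (W false u v).
have gf : gram f.
  have g2 := gram_const T (ler0n R 2).
  have gC b := gramD g2 (gram_scaled_chebyshev m (gW b)).
  exact: gramD (gramM (gW true) (gC false)) (gramM (gW false) (gC true)).
have fsum := gram_sum_ge0 X gf.
pose J := ((2 * m.+1) ^ 2 + 7)%N.
pose wt (i : nat) : R := 7 * expR (5 * i%:R + 5).
have wt0 i : 0 <= wt i by rewrite mulr_ge0 ?expR_ge0.
have pointwise u v : f u v + 1 <=
    \sum_(i < J) wt i * ((hit true i u v)%:R + (hit false i u v)%:R).
  have rhs0 : 0 <= \sum_(i < J) wt i * ((hit true i u v)%:R + (hit false i u v)%:R).
    by apply: sumr_ge0 => i _; rewrite mulr_ge0 // addr_ge0.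
  have [t6|t6] := ltrP (W true u v) (- 6).
    apply: le_trans rhs0; have := symmetric_test_low (mW true u v) (mW false u v) t6.
    by rewrite /f; lra.
  have [f6|f6] := ltrP (W false u v) (- 6).
    apply: le_trans rhs0; have := symmetric_test_low (mW false u v) (mW true u v) f6.
    by rewrite symmetric_testC /f; lra.
  (* Only the summand with j the integral part of s and b the larger of the two
     kernels is needed. *)
  have [b Wb] : exists b, forall b', W b' u v <= W b u v.
    have [le|le] := lerP (W true u v) (W false u v).
      by exists false => -[].
    by exists true => -[] //; exact: ltW.
  set w := W b u v in Wb.
  have w6 : 0 <= w + 6 by have := Wb true; lra.
  pose s := Num.sqrt (w + 6); have s0 : 0 <= s by exact: sqrtr_ge0.
  have s2 : s ^+ 2 = w + 6 by rewrite sqr_sqrtr.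
  pose j := Num.truncn s.
  have /andP[js sj] : j%:R <= s < j.+1%:R by exact: truncn_itv.
  have jJ : (j < J)%N.
    rewrite -(ltr_nat R); apply: le_lt_trans js _.
    rewrite -(@ltr_pXn2r _ 2) ?nnegrE // s2.
    have := mW b u v; rewrite ltr_norml -/w => /andP[_ wm].
    have JE : J%:R = (2 * m.+1%:R) ^+ 2 + 7 :> R by rewrite /J natrD natrX natrM.
    have : J%:R <= J%:R ^+ 2 :> R by rewrite expr2 ler_peMr // ler1n /J addn_gt0 orbT.
    by rewrite {1}JE; lra.
  have hj : hit b j u v.
    rewrite /hit; apply/andP; split; last by case: (b).
    have : j%:R ^+ 2 <= s ^+ 2 by rewrite ler_pXn2r ?nnegrE.
    by rewrite s2 -/w; lra.
  have fle : f u v <= 6 * expR (5 * s).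
    apply: symmetric_test_high => //; apply/andP; split=> //.
      by have := Wb true; rewrite s2; lra.
    by have := Wb false; rewrite s2; lra.
  have e1 : 1 <= expR (5 * s) by rewrite -[leLHS]expR0 ler_expR; lra.
  have es : expR (5 * s) <= expR (5 * j%:R + 5).
    by rewrite ler_expR; move: sj; rewrite -natr1; lra.
  rewrite (bigD1 (Ordinal jJ)) //= -[leLHS]addr0; apply: lerD; last first.
    by apply: sumr_ge0 => i _; rewrite mulr_ge0 // addr_ge0.
  apply: le_trans (_ : wt j * 1 <= _); first by rewrite /wt; lra.
  rewrite ler_wpM2l //; case: (b) hj => ->; rewrite ?lerDl ?lerDr //.
have upper : \sum_(u in X) \sum_(v in X) (f u v + 1) <=
    \sum_(i < J) wt i * (2 * (beta * expR (- (6 * i%:R)) * N * N)).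
  apply: le_trans (_ : \sum_(u in X) \sum_(v in X)
      \sum_(i < J) wt i * ((hit true i u v)%:R + (hit false i u v)%:R) <= _).
    by do 2![apply: ler_sum => ? _].
  under eq_bigr do rewrite exchange_big /=.
  rewrite exchange_big /=; apply: ler_sum => i _.
  under eq_bigr do rewrite -mulr_sumr.
  rewrite -mulr_sumr ler_wpM2l // (_ : 2 * _ = \sum_(u in X) 2 * (beta * expR (- (6 * i%:R)) * N)).
    apply: ler_sum => u uX; rewrite big_split /=.
    by have := few true i u uX; have := few false i u uX; lra.
  by rewrite sumr_const -[RHS]mulr_natr -/N; ring.
have lower : N * N <= \sum_(u in X) \sum_(v in X) (f u v + 1).
  under eq_bigr do rewrite big_split /=.
  rewrite big_split /= (_ : \sum_(u in X) \sum_(v in X) 1 = N * N) ?lerDr //.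
  by rewrite sumr_const [X in X *+ _]sumr_const mulr_natr.
have : N * N <= 28 / 29 * (N * N).
  apply: le_trans lower _; apply: le_trans upper _.
  have -> : \sum_(i < J) wt i * (2 * (beta * expR (- (6 * i%:R)) * N * N)) =
     14 / 29 * (N * N) * \sum_(i < J) expR (- i%:R).
    rewrite mulr_sumr; apply: eq_bigr => i _; rewrite /wt /beta /overlap_const.
    have -> : expR (- i%:R) = expR (5 * i%:R + 5) * expR (- (6 * i%:R)) / expR 5 :> R.
      by rewrite -expRN -!expRD; congr expR; lra.
    by field; rewrite gt_eqF ?expR_gt0.
  have := ler_wpM2l (_ : 0 <= 14 / 29 * (N * N)) (sum_expRN_le2 J).
  move=> /(_ _) H; apply: le_trans (H _) _; first by rewrite !mulr_ge0 //; lra.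
  by lra.
have := mulr_gt0 N0 N0; lra.
Qed.

End Geometry.

(** * One step of the search for a book *)

Lemma card_subset_exists (T : finType) (A : {set T}) k : (k <= #|A|)%N ->
  exists2 B : {set T}, B \subset A & #|B| = k.
Proof.
move=> kA; exists [set z in take k (enum A)].
  by apply/subsetP => z; rewrite inE => /mem_take; rewrite mem_enum.
rewrite cardsE; have /card_uniqP -> : uniq (take k (enum A)) by rewrite take_uniq ?enum_uniq.
by rewrite size_takel // -cardE.
Qed.

Section DensityStep.
Variables (R : realType) (T : finType) (c : T -> T -> bool).

(** Apply [gram_overlap] to the centred indicators of equal-sized sets of colour-b
    neighbours in [Y b], scaled so that the level - 6 of the kernel means a density
    drop of [alpha b].  The number [j] measures a density increase in colour
    [b] of order j ^ 2, and the reservoir pays for it only linearly in the exponent. *)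
Lemma density_step (X : {set T}) (Y : bool -> {set T}) (d : bool -> nat)
    (alpha : bool -> R) :
  X != set0 -> (forall b, 0 < d b)%N -> (forall b, 0 < alpha b) ->
  (forall b x, x \in X -> (d b <= #|Y b :&: nbr c b x|)%N) ->
  exists x b (j : nat) (X' : {set T}) (Y' : bool -> {set T}),
    [/\ x \in X, X' \subset X &
        overlap_const R * expR (- (6 * j%:R)) * #|X|%:R <= #|X'|%:R] /\
    [/\ forall b', Y' b' \subset Y b' :&: nbr c b' x /\ #|Y' b'| = d b',
        forall b' y, y \in X' ->
          ((d b')%:R / #|Y b'|%:R - alpha b') * (d b')%:R <= #|Y' b' :&: nbr c b' y|%:R &
        forall y, y \in X' ->
          ((d b)%:R / #|Y b|%:R + (j%:R ^+ 2 / 6 - 1) * alpha b) * (d b)%:R <=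
            #|Y' b :&: nbr c b y|%:R].
Proof.
move=> X0 d0 a0 deg.
have [Z ZP] : exists Z : bool -> T -> {set T}, forall b x, x \in X ->
    Z b x \subset Y b :&: nbr c b x /\ #|Z b x| = d b.
  have ex b x : exists B : {set T}, x \in X -> B \subset Y b :&: nbr c b x /\ #|B| = d b.
    have [xX|] := boolP (x \in X); last by exists set0.
    by have [B BY Bd] := card_subset_exists (deg b x xX); exists B.
  have [Z ZP] := choice (fun bx : bool * T => ex bx.1 bx.2).
  by exists (fun b x => Z (b, x)) => b x; exact: (ZP (b, x)).
pose p b : R := (d b)%:R / #|Y b|%:R.
pose phi b y u : R := if y \in Y b then (y \in Z b u)%:R - p b else 0.
(* On X this is 6 (#|Z u :&: Z v| - p d) / (alpha d), by [WE]. *)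
pose W b u v := 6 / (alpha b * (d b)%:R) * \sum_y phi b y u * phi b y v.
have dR b : 0 < (d b)%:R :> R by rewrite ltr0n.
have gW b : gram (W b).
  apply: gramM; first by apply: gram_const; rewrite divr_ge0 // mulr_ge0 ?ltW.
  by exists T, (phi b).
have ZY b u : u \in X -> Z b u \subset Y b.
  by move=> /(ZP b) [ZY _]; apply: subset_trans ZY _; exact: subsetIl.
have sumZ b u : u \in X -> \sum_(y in Y b) (y \in Z b u)%:R = (d b)%:R :> R.
  move=> uX; rewrite -(ZP b u uX).2 -sum1_card natr_sum big_mkcond [RHS]big_mkcond /=.
  apply: eq_bigr => y _; case: (boolP (y \in Z b u)) => [yZ|yZ].
    by rewrite (subsetP (ZY b u uX)).
  by case: ifP.
have WE b u v : u \in X -> v \in X ->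
    W b u v = 6 / (alpha b * (d b)%:R) * (#|Z b u :&: Z b v|%:R - p b * (d b)%:R).
  move=> uX vX; rewrite /W; congr (_ * _).
  rewrite (bigID (mem (Y b))) /= addrC big1 ?add0r; last first.
    by move=> y yY; rewrite /phi (negPf yY) mul0r.
  rewrite (eq_bigr (fun y => (y \in Z b u :&: Z b v)%:R - p b * (y \in Z b u)%:R
       - p b * (y \in Z b v)%:R + p b * p b)); last first.
    move=> y yY; rewrite /phi yY inE.
    by case: (y \in Z b u); case: (y \in Z b v) => /=; ring.
  rewrite big_split /= sumrB sumrB -!mulr_sumr !sumZ // sumr_const.
  have -> : \sum_(y in Y b) (y \in Z b u :&: Z b v)%:R = #|Z b u :&: Z b v|%:R :> R.
    rewrite -sum1_card natr_sum big_mkcond [RHS]big_mkcond /=; apply: eq_bigr => y _.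
    case: (boolP (y \in Z b u :&: Z b v)) => [yZ|yZ]; last by case: ifP.
    by rewrite (subsetP (ZY b u uX)) //; move: yZ; rewrite inE => /andP[].
  have pY : p b * #|Y b|%:R = (d b)%:R.
    rewrite divfK // pnatr_eq0 -lt0n; apply: leq_trans (subset_leq_card (ZY b u uX)).
    by rewrite (ZP b u uX).2.
  have -> : (d b)%:R * (#|Y b|%:R^-1 *+ #|Y b|) = (d b)%:R :> R.
    by rewrite mulrnAr -[LHS]mulr_natr.
  by ring.
have [u [b [j [uX Xbig]]]] := gram_overlap X0 gW.
set X' := [set v in X | _] in Xbig.
have X'X : X' \subset X by apply/subsetP => v; rewrite inE => /andP[].
have key b' y lam : y \in X -> lam * 6 - 6 <= W b' u y ->
    (p b' + (lam - 1) * alpha b') * (d b')%:R <= #|Z b' u :&: nbr c b' y|%:R.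
  move=> yX; rewrite WE // => H.
  apply: le_trans (_ : #|Z b' u :&: Z b' y|%:R <= _); last first.
    rewrite ler_nat; apply: subset_leq_card; apply: setIS.
    by apply: subset_trans (ZP b' y yX).1 _; exact: subsetIr.
  have D0 : 0 < alpha b' * (d b')%:R / 6 by rewrite divr_gt0 // mulr_gt0.
  move: H; rewrite -(ler_pM2l D0) mulrA.
  have -> : alpha b' * (d b')%:R / 6 * (6 / (alpha b' * (d b')%:R)) = 1.
    by field; rewrite !gt_eqF.
  by rewrite mul1r; lra.
have W6 b' y : y \in X' -> - 6 <= W b' u y.
  rewrite inE => /and3P[_ H1 H2]; have [->|/negPf nb] := eqVneq b' b.
    by apply: le_trans H1; have := sqr_ge0 (j%:R : R); lra.
  by have <- : ~~ b = b' by move: nb; case: (b); case: (b').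
exists u, b, j, X', (fun b' => Z b' u); do 2!split=> //.
- by move=> b'; exact: ZP.
- move=> b' y yX'; have := key b' y 0 (subsetP X'X _ yX').
  by rewrite mul0r !sub0r mulN1r; apply; exact: W6.
- move=> y yX'; apply: key; first exact: (subsetP X'X).
  by move: yX'; rewrite inE => /and3P[_ H _]; move: H; lra.
Qed.

End DensityStep.

(** * Monochromatic books *)

Section LnBounds.
Variable R : realType.
Implicit Types x y : R.

Lemma ln1D_ge_half y : 0 <= y <= 1 -> y / 2 <= ln (1 + y).
Proof.
move=> /andP[y0 y1]; rewrite -ler_expR lnK ?posrE; last by lra.
rewrite -[leLHS]invrK -expRN; have h : 1 - y / 2 <= expR (- (y / 2)).
  by apply: le_trans (expR_ge1Dx _); lra.
apply: le_trans (_ : (1 - y / 2)^-1 <= _).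
  by rewrite lef_pV2 ?posrE ?expR_gt0 //; lra.
rewrite -[leLHS]mul1r ler_pdivrMr; last by lra.
have : 0 <= y * (1 - y) by rewrite mulr_ge0; lra.
by lra.
Qed.

Lemma ln1B_ge x : 0 <= x <= 1 / 2 -> - (2 * x) <= ln (1 - x).
Proof.
move=> /andP[x0 x1]; rewrite -ler_expR lnK ?posrE; last by lra.
rewrite expRN -[leRHS]invrK lef_pV2 ?posrE ?invr_gt0 ?expR_gt0 //; last by lra.
apply: le_trans (_ : 1 + 2 * x <= _); last exact: expR_ge1Dx.
rewrite -[leLHS]mul1r ler_pdivrMr; last by lra.
have : 0 <= x * (1 - 2 * x) by rewrite mulr_ge0; lra.
by lra.
Qed.

End LnBounds.

Lemma min_value (R : realType) (T : finType) (X : {set T}) (f : T -> nat) (r : R) :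
  X != set0 -> (forall x, x \in X -> r <= (f x)%:R) ->
  exists2 d, r <= d%:R & (forall x, x \in X -> (d <= f x)%N).
Proof.
move=> /set0Pn[x0 x0X] rf; exists (f [arg min_(x < x0 in X) f x]).
  by case: arg_minnP => // x xX _; exact: rf.
by case: arg_minnP => // x xX xmin y yX; exact: xmin.
Qed.

Section Book.
Variables (R : realType) (T : finType) (c : T -> T -> bool).
Hypothesis csym : symmetric c.
Variables (t J : nat) (delta : R) (a M : bool -> R).
Hypotheses (t_gt0 : (0 < t)%N) (J_ge4 : (4 <= J)%N).
Hypothesis J_overlap : - ln (overlap_const R) <= J%:R.
Hypothesis delta_01 : 0 < delta <= 1.
Hypothesis J_small : J%:R ^+ 2 <= 12 * delta * t%:R.
Hypothesis a_01 : forall b, 0 < a b <= 1.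
Hypothesis M_gt0 : forall b, 0 < M b.

(** Exchange rate between one unit of the logarithm of a density surplus and
    logarithmic size of [X]; [boost_cost_Y] is the same for the sets [Y b]. *)
Definition boost_cost_X : R := 336 * t%:R / J%:R.
Definition step_cost_X : R := 7 * J%:R + 2 + 336 / J%:R.
Definition boost_cost_Y b : R := 48 * t%:R * (- ln (a b)) / J%:R ^+ 2.
Definition step_cost_Y b : R := - ln (a b) + 48 * (- ln (a b)) / J%:R ^+ 2.

(** Surplus of the density in colour [b] over the floor [a b].  Density losses are
    proportional to the surplus, so the floor is never reached. *)
Definition height b (Z : {set T}) (d : nat) : R := d%:R / #|Z|%:R - a b.

(** Sizes sufficient to find a book: [u b] is the number of vertices still to be
    added to the clique of colour [b].  The terms with the logarithm of the height
    form a potential: a density increment raises the height and thereby pays for its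
    own cost. *)
Record book_state (X : {set T}) (Y : bool -> {set T}) (d u : bool -> nat) : Prop := BookState {
  bs_deg : forall b x, x \in X -> (d b <= #|Y b :&: nbr c b x|)%N;
  bs_height : forall b, delta * (t + u b)%:R / (2 * t%:R) <= height b (Y b) (d b);
  bs_X : expR ((u true + u false)%:R * step_cost_X -
      boost_cost_X * (ln (height true (Y true) (d true)) + ln (height false (Y false) (d false))))
      <= #|X|%:R;
  bs_Y : forall b, M b * expR ((u b)%:R * step_cost_Y b -
      boost_cost_Y b * ln (height b (Y b) (d b))) <= #|Y b|%:R;
  bs_u : forall b, (u b <= t)%N }.

Definition upd (A : Type) (f : bool -> A) (e : bool) (v : A) : bool -> A :=
  fun b => if b == e then v else f b.

Lemma upd_same A (f : bool -> A) e v : upd f e v e = v.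
Proof. by rewrite /upd eqxx. Qed.

Lemma upd_other A (f : bool -> A) e v : upd f e v (~~ e) = f (~~ e).
Proof. by rewrite /upd; case: e. Qed.

Lemma bool_sumE (F : bool -> R) e : F true + F false = F e + F (~~ e).
Proof. by case: e; rewrite // addrC. Qed.

(** Common bookkeeping of the two kinds of step.  In both of them the reservoir
    shrinks, and of the two sets [Y b] only [Y e] changes. *)
Lemma book_state_upd X Y d u e (X' Z : {set T}) (d' u' : nat) :
  book_state X Y d u -> X' \subset X -> Z \subset Y e -> #|Z| = d e ->
  (u' <= u e)%N ->
  (forall y, y \in X' -> (d' <= #|Z :&: nbr c e y|)%N) ->
  delta * (t + u')%:R / (2 * t%:R) <= height e Z d' ->
  #|X|%:R * expR (- (u e - u')%:R * step_cost_X -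
    boost_cost_X * (ln (height e Z d') - ln (height e (Y e) (d e)))) <= #|X'|%:R ->
  - ln (a e) <= (u e - u')%:R * step_cost_Y e +
    boost_cost_Y e * (ln (height e Z d') - ln (height e (Y e) (d e))) ->
  book_state X' (upd Y e Z) (upd d e d') (upd u e u').
Proof.
move=> [deg hgt sX sY ut] XX ZY Zd u'u deg' hgt' sX' sY'.
have uE : (u e)%:R = (u e - u')%:R + u'%:R :> R by rewrite -natrD subnK.
split.
- move=> b x xX'; rewrite /upd; case: eqP => [->|_]; first exact: deg'.
  by apply: deg; exact: (subsetP XX).
- by move=> b; rewrite /upd; case: eqP => [->|_].
- apply: le_trans sX'; apply: le_trans (ler_wpM2r (expR_ge0 _) sX).
  rewrite -expRD ler_expR !natrD.
  rewrite (bool_sumE (fun b => ln (height b (upd Y e Z b) (upd d e d' b))) e).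
  rewrite (bool_sumE (fun b => ln (height b (Y b) (d b))) e).
  rewrite (bool_sumE (fun b => (upd u e u' b)%:R) e) (bool_sumE (fun b => (u b)%:R) e).
  by rewrite !upd_same !upd_other uE; lra.
- move=> b; rewrite /upd; case: eqP => [->|_]; last exact: sY.
  have /andP[a0 a1] := a_01 e.
  have Yd : a e * #|Y e|%:R <= (d e)%:R.
    have [Y0|Yn0] := posnP #|Y e|; first by rewrite Y0 mulr0.
    rewrite -ler_pdivlMr ?ltr0n // -subr_ge0; apply: le_trans (hgt e).
    by case/andP: delta_01 => /ltW ? _; rewrite divr_ge0 ?mulr_ge0.
  rewrite Zd; apply: le_trans Yd; apply: le_trans (ler_wpM2l (ltW a0) (sY e)).
  rewrite mulrCA ler_pM2l // -[X in _ <= X * _]lnK ?posrE // -expRD ler_expR uE.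
  by move: sY'; lra.
- by move=> b; rewrite /upd; case: eqP => // _; exact: leq_trans u'u (ut e).
Qed.


Let tR : 0 < t%:R :> R. Proof. by rewrite ltr0n. Qed.
Let J4 : 4 <= J%:R :> R. Proof. by rewrite -[4]/(4%:R) ler_nat. Qed.
Let J0 : 0 < J%:R :> R. Proof. by have := J4; lra. Qed.

Lemma boost_cost_X_gt0 : 0 < boost_cost_X.
Proof. by rewrite divr_gt0 ?mulr_gt0 ?ltr0n //; lia. Qed.

Lemma ln_a_le0 b : ln (a b) <= 0.
Proof. by apply: ln_le0; case/andP: (a_01 b). Qed.

Lemma boost_cost_Y_ge0 b : 0 <= boost_cost_Y b.
Proof. by rewrite !mulr_ge0 ?oppr_ge0 ?ln_a_le0 ?invr_ge0 ?exprn_ge0 ?ler0n. Qed.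

Lemma step_cost_X_ge : 7 * J%:R + 2 <= step_cost_X.
Proof. by rewrite /step_cost_X lerDl divr_ge0 ?ler0n. Qed.

Lemma height_ge X Y d u b : book_state X Y d u -> delta / 2 <= height b (Y b) (d b).
Proof.
move=> st; apply: le_trans (bs_height st b); case/andP: delta_01 => d0 _.
rewrite natrD ler_pdivlMr ?mulr_gt0 //.
have : 0 <= delta * (u b)%:R by rewrite mulr_ge0 // ltW.
by lra.
Qed.

Lemma height_le b (Z : {set T}) d : (d <= #|Z|)%N -> height b Z d <= 1 - a b.
Proof.
move=> dZ; rewrite /height lerD2r.
have [->|Z0] := posnP #|Z|; first by rewrite invr0 mulr0.
by rewrite ler_pdivrMr ?ltr0n // mul1r ler_nat.
Qed.

Lemma book_state_X_gt0 X Y d u : book_state X Y d u -> X != set0.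
Proof.
by case=> _ _ sX _ _; rewrite -card_gt0 -(ltr0n R); apply: lt_le_trans sX; exact: expR_gt0.
Qed.

Lemma book_state_deg_le X Y d u b : book_state X Y d u -> (d b <= #|Y b|)%N.
Proof.
move=> st; have /set0Pn[x xX] := book_state_X_gt0 st.
by apply: leq_trans (bs_deg st b xX) _; rewrite subset_leq_card // subsetIl.
Qed.

Lemma ln_height_le0 X Y d u b : book_state X Y d u -> ln (height b (Y b) (d b)) <= 0.
Proof.
move=> st; apply: ln_le0; have := height_le b (book_state_deg_le b st).
by case/andP: (a_01 b); lra.
Qed.

(** At most one vertex of [X], namely [x], is adjacent to [x] in neither colour. *)
Lemma large_nbr (X : {set T}) x : (3 <= #|X|)%N ->
  exists e, #|X|%:R <= 3 * #|X :&: nbr c e x|%:R :> R.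
Proof.
move=> X3; have : (#|X| <= #|X :&: nbr c true x| + #|X :&: nbr c false x| + 1)%N.
  have [xX|xX] := boolP (x \in X); first by rewrite (card_nbr_split c true xX) addn1.
  apply: leq_trans (leq_addr _ _); rewrite -cardsUI; apply: leq_trans (leq_addr _ _).
  apply: subset_leq_card; apply/subsetP => y yX; rewrite !inE yX /=.
  by case: eqP yX xX => [-> ->|_ _ _] //=; case: (c x y).
move=> H; have [le|le] := leqP #|X :&: nbr c false x| #|X :&: nbr c true x|.
  by exists true; rewrite -[3]/(3%:R) -natrM ler_nat; lia.
by exists false; rewrite -[3]/(3%:R) -natrM ler_nat; lia.
Qed.

(** A step without large density increment: [x] joins the clique of colour [e].  The
    height drops by a factor 1 - 1 / (2 t) at most, and the per-step costs cover
    the resulting change of the potential. *)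
Lemma colour_step X Y d u x e (X' Z : {set T}) (j : nat) :
  book_state X Y d u -> (0 < u e)%N -> (j <= J)%N -> X' \subset X ->
  overlap_const R * expR (- (6 * j%:R)) * #|X|%:R <= #|X'|%:R ->
  #|X'|%:R <= 3 * #|X' :&: nbr c e x|%:R :> R ->
  Z \subset Y e -> #|Z| = d e ->
  (forall y, y \in X' -> ((d e)%:R / #|Y e|%:R - height e (Y e) (d e) / (2 * t%:R)) *
     (d e)%:R <= #|Z :&: nbr c e y|%:R) ->
  exists d', book_state (X' :&: nbr c e x) (upd Y e Z) (upd d e d') (upd u e (u e).-1).
Proof.
move=> st ue jJ X'X X'big X''big ZY Zd degZ.
have X0 : 0 < #|X|%:R :> R by rewrite ltr0n card_gt0 (book_state_X_gt0 st).
have b0 := overlap_const_gt0 R.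
have X'0 : 0 < #|X'|%:R :> R.
  by apply: lt_le_trans X'big; rewrite !mulr_gt0 ?expR_gt0.
have X''0 : X' :&: nbr c e x != set0.
  by rewrite -card_gt0 -(ltr0n R); lra.
set h := height e (Y e) (d e) in degZ *.
have [d' d'ge d'le] := min_value X''0
  (fun y yX => degZ y (subsetP (subsetIl X' (nbr c e x)) y yX)).
have [dl0 dl1] := andP delta_01.
have h0 : 0 < h by have := height_ge e st; rewrite -/h; lra.
have d0 : 0 < (d e)%:R :> R.
  have /andP[a0 _] := a_01 e; have : 0 < (d e)%:R / #|Y e|%:R :> R.
    by move: h0; rewrite /h /height; lra.
  by rewrite ltr0n lt0n; apply: contraTneq => ->; rewrite mul0r ltxx.
pose z : R := (2 * t%:R)^-1.
have z0 : 0 < z by rewrite invr_gt0 mulr_gt0.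
have zh : z <= 1 / 2.
  rewrite mul1r lef_pV2 ?posrE ?mulr_gt0 //.
  have : 1 <= t%:R :> R by rewrite ler1n.
  by lra.
have h' : h * (1 - z) <= height e Z d'.
  rewrite /height Zd lerBrDr ler_pdivlMr //; apply: le_trans d'ge.
  by rewrite ler_pM2r // /h /height -/z; lra.
have hz0 : 0 < h * (1 - z) by rewrite mulr_gt0 //; lra.
have lnh : - (2 * z) <= ln (height e Z d') - ln h.
  have : ln (h * (1 - z)) <= ln (height e Z d').
    by rewrite ler_ln ?posrE // (lt_le_trans hz0).
  rewrite lnM ?posrE //; last by lra.
  have : - (2 * z) <= ln (1 - z) by apply: ln1B_ge; lra.
  by lra.
have uu : (u e - (u e).-1 = 1)%N by case: (u e) ue => // n _; rewrite subSnn.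
exists d'; apply: (book_state_upd st _ _ Zd) => //.
- by apply: subset_trans X'X; exact: subsetIl.
- exact: leq_pred.
- apply: le_trans h'; have := bs_height st e; rewrite -/h.
  have vE : (t + u e)%:R = (t + (u e).-1)%:R + 1 :> R by rewrite natr1 -addnS prednK.
  have vt : (t + u e)%:R * z <= 1.
    rewrite ler_pdivrMr ?mulr_gt0 // mul1r -[2]/(2%:R) -natrM ler_nat.
    by rewrite mul2n -addnn leq_add2l (bs_u st e).
  rewrite -/z => hge; apply: le_trans (ler_wpM2r (_ : 0 <= 1 - z) hge); last by lra.
  have : 0 <= delta * z * (1 - (t + u e)%:R * z).
    by rewrite !mulr_ge0 ?subr_ge0 // ltW.
  by rewrite vE; lra.
- rewrite uu; apply: le_trans (_ : #|X|%:R * expR (- (7 * J%:R + 2)) <= _).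
    rewrite ler_pM2l // ler_expR /step_cost_X.
    have kz : boost_cost_X * (2 * z) = 336 / J%:R.
      by rewrite /boost_cost_X /z; field; rewrite !gt_eqF.
    have := ler_wpM2l (ltW boost_cost_X_gt0) lnh; rewrite mulrN kz -/h.
    by lra.
  rewrite opprD expRD mulrA.
  have e3 : expR (- 2) <= 3^-1 :> R.
    by rewrite expRN lef_pV2 ?posrE ?expR_gt0 //; apply: le_trans (expR_ge1Dx _); lra.
  apply: le_trans (ler_wpM2l (_ : 0 <= #|X|%:R * expR (- (7 * J%:R))) e3) _.
    by rewrite mulr_ge0 ?expR_ge0.
  rewrite ler_pdivrMr // mulrC [_ * 3]mulrC; apply: le_trans X''big.
  apply: le_trans X'big; rewrite ler_pM2r // -[overlap_const R]lnK ?posrE //.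
  rewrite -expRD ler_expR.
  have : j%:R <= J%:R :> R by rewrite ler_nat.
  by move: J_overlap; lra.
- rewrite uu mul1r /step_cost_Y -/h.
  have nz : boost_cost_Y e * (2 * z) = 48 * (- ln (a e)) / J%:R ^+ 2.
    by rewrite /boost_cost_Y /z; field; rewrite !gt_eqF.
  have := ler_wpM2l (boost_cost_Y_ge0 e) lnh; rewrite mulrN nz.
  by lra.
Qed.


(** Let y = j ^ 2 / (24 t), so that the height grows by a factor 1 + y at least.  For
    y <= 1 the logarithm is at least y / 2, quadratic in j, which beats 7 j once
    J <= j.  For y > 1 it is at least 1 / 2, and j is bounded, since a height
    of at least delta / 2 cannot grow beyond 1. *)
Lemma boost_gain (h h' : R) (j : nat) : (J <= j)%N -> delta / 2 <= h -> h' <= 1 ->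
  h * (1 + (j%:R ^+ 2 / 6 - 1) / (2 * t%:R)) <= h' ->
  [/\ h < h', 7 * j%:R <= boost_cost_X * (ln h' - ln h) &
  J%:R ^+ 2 / (48 * t%:R) <= ln h' - ln h].
Proof.
move=> Jj hd h'1 hh'.
have [dl0 dl1] := andP delta_01; have h0 : 0 < h by lra.
have jR : J%:R <= j%:R :> R by rewrite ler_nat.
pose y : R := j%:R ^+ 2 / (24 * t%:R).
pose y0 : R := J%:R ^+ 2 / (24 * t%:R).
have t24 : 0 < 24 * t%:R :> R by rewrite mulr_gt0 ?ltr0n.
have yt : y * (24 * t%:R) = j%:R ^+ 2 by rewrite divfK // gt_eqF.
have y0t : y0 * (24 * t%:R) = J%:R ^+ 2 by rewrite divfK // gt_eqF.
have y0_gt0 : 0 < y0 by rewrite divr_gt0 // exprn_gt0.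
have sqJ : J%:R ^+ 2 <= j%:R ^+ 2 :> R by rewrite ler_pXn2r ?nnegrE.
have y0y : y0 <= y by rewrite ler_pM2r ?invr_gt0.
have y0_le1 : y0 <= 1.
  rewrite ler_pdivrMr // mul1r; apply: le_trans J_small _.
  by rewrite ler_pM2r //; lra.
have j16 : 16 <= j%:R ^+ 2 :> R.
  by apply: le_trans sqJ; have := ler_pM (ler0n R 4) (ler0n R 4) J4 J4; rewrite expr2; lra.
have h'y : h * (1 + y) <= h'.
  apply: le_trans hh'; rewrite ler_pM2l // lerD2l.
  rewrite ler_pdivlMr ?mulr_gt0 //.
  have -> : y * (2 * t%:R) = j%:R ^+ 2 / 12 by rewrite -yt; field.
  by lra.
have lny : ln (1 + y) <= ln h' - ln h.
  have : ln (h * (1 + y)) <= ln h'.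
    rewrite ler_ln ?posrE //; first by rewrite mulr_gt0 //; lra.
    by apply: lt_le_trans h'y; rewrite mulr_gt0 //; lra.
  by rewrite lnM ?posrE //; lra.
have lny0 : ln (1 + y0) <= ln (1 + y) by rewrite ler_ln ?posrE //; lra.
have k0 := boost_cost_X_gt0.
have y_gt0 : 0 < y by lra.
split; [by apply: lt_le_trans h'y; rewrite ltr_pMr //; lra | | ];
  last first.
  have -> : J%:R ^+ 2 / (48 * t%:R) = y0 / 2 :> R by rewrite /y0; field; rewrite gt_eqF.
  by apply: le_trans lny; apply: le_trans lny0; apply: ln1D_ge_half; rewrite ltW.
apply: le_trans (ler_wpM2l (ltW k0) lny).
have j0 : 0 < j%:R :> R by exact: lt_le_trans J0 jR.
have kJ : boost_cost_X * J%:R = 336 * t%:R by rewrite divfK // gt_eqF.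
rewrite -(ler_pM2r J0) [boost_cost_X * _ * _]mulrAC kJ.
have [y1|y1] := lerP y 1.
  have ly : y / 2 <= ln (1 + y) by apply: ln1D_ge_half; rewrite y1 andbT; lra.
  apply: le_trans (ler_wpM2l (_ : 0 <= 336 * t%:R) ly); last by rewrite mulr_ge0 ?ler0n.
  have -> : 336 * t%:R * (y / 2) = 7 * (y * (24 * t%:R)) by field.
  by rewrite yt; have := ler_wpM2l (ltW j0) jR; lra.
have ly : 1 / 2 <= ln (1 + y).
  apply: le_trans (_ : ln (1 + 1) <= _); first by apply: ln1D_ge_half; lra.
  by rewrite ler_ln ?posrE //; lra.
apply: le_trans (ler_wpM2l (_ : 0 <= 336 * t%:R) ly); last by rewrite mulr_ge0 ?ler0n.
suff : j%:R * J%:R <= 24 * t%:R :> R by lra.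
rewrite -(@ler_pXn2r _ 2) ?nnegrE ?mulr_ge0 ?ler0n // exprMn.
have dy : delta * y <= 2.
  have : h * y <= 1 by move: h'y; lra.
  have : (delta / 2) * y <= h * y by rewrite ler_wpM2r //; lra.
  by lra.
rewrite -yt; apply: le_trans (ler_wpM2l (_ : 0 <= y * (24 * t%:R)) J_small) _.
  by rewrite mulr_ge0 ?ltW //; lra.
have -> : y * (24 * t%:R) * (12 * delta * t%:R) = (delta * y) * (288 * t%:R ^+ 2) by ring.
apply: le_trans (ler_wpM2r (_ : 0 <= 288 * t%:R ^+ 2) dy) _.
  by rewrite mulr_ge0 ?ler0n ?sqr_ge0.
by lra.
Qed.

Lemma boost_step X Y d u e (X' Z : {set T}) (j : nat) :
  book_state X Y d u -> (J <= j)%N -> X' \subset X ->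
  overlap_const R * expR (- (6 * j%:R)) * #|X|%:R <= #|X'|%:R ->
  Z \subset Y e -> #|Z| = d e ->
  (forall y, y \in X' -> ((d e)%:R / #|Y e|%:R +
     (j%:R ^+ 2 / 6 - 1) * (height e (Y e) (d e) / (2 * t%:R))) *
     (d e)%:R <= #|Z :&: nbr c e y|%:R) ->
  (d e < #|Y e|)%N /\ exists d', book_state X' (upd Y e Z) (upd d e d') (upd u e (u e)).
Proof.
move=> st Jj X'X X'big ZY Zd degZ.
have X0 : 0 < #|X|%:R :> R by rewrite ltr0n card_gt0 (book_state_X_gt0 st).
have b0 := overlap_const_gt0 R.
have X'0 : X' != set0.
  rewrite -card_gt0 -(ltr0n R); apply: lt_le_trans X'big.
  by rewrite !mulr_gt0 ?expR_gt0.
set h := height e (Y e) (d e) in degZ *.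
have [d' d'ge d'le] := min_value X'0 degZ.
have hge : delta / 2 <= h by exact: (height_ge e st).
have [dl0 dl1] := andP delta_01; have h0 : 0 < h by lra.
have [a0 a1] := andP (a_01 e).
have d0 : 0 < (d e)%:R :> R.
  have : 0 < (d e)%:R / #|Y e|%:R :> R by move: h0; rewrite /h /height; lra.
  by rewrite ltr0n lt0n; apply: contraTneq => ->; rewrite mul0r ltxx.
have hh' : h * (1 + (j%:R ^+ 2 / 6 - 1) / (2 * t%:R)) <= height e Z d'.
  rewrite /height Zd lerBrDr ler_pdivlMr //; apply: le_trans d'ge.
  by rewrite ler_pM2r // /h /height; lra.
have d'Z : (d' <= #|Z|)%N.
  have /set0Pn[y yX'] := X'0; apply: leq_trans (d'le y yX') _.
  by rewrite subset_leq_card // subsetIl.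
have h'a := height_le e d'Z.
have h'1 : height e Z d' <= 1 by lra.
have [hlt gX gY] := boost_gain Jj hge h'1 hh'.
split.
  rewrite ltn_neqAle (book_state_deg_le e st) andbT; apply/eqP => dY.
  by move: hlt h'a; rewrite /h /height -dY divff ?gt_eqF //; lra.
exists d'; apply: (book_state_upd st _ _ Zd) => //.
- by apply: le_trans (bs_height st e) _; exact: ltW.
- rewrite subnn mulr0n oppr0 mul0r add0r -/h; apply: le_trans X'big.
  rewrite mulrC ler_pM2r // -[overlap_const R]lnK ?posrE // -expRD ler_expR.
  have : J%:R <= j%:R :> R by rewrite ler_nat.
  by move: J_overlap gX; lra.
- rewrite subnn mulr0n mul0r add0r -/h.
  apply: le_trans (ler_wpM2l (boost_cost_Y_ge0 e) gY).
  by rewrite le_eqVlt; apply/orP; left; apply/eqP; rewrite /boost_cost_Y; field; rewrite !gt_eqF.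
Qed.

(** Induction on the number of missing clique vertices plus the sizes of the sets
    [Y b].  Density increments shrink [Y b] strictly, as a density already
    equal to 1 leaves no room for an increment. *)
Lemma monochromatic_book X Y d u : book_state X Y d u ->
  exists b (A Z : {set T}),
    [/\ A \subset X, #|A| = u b & monochromatic c b A] /\
    [/\ Z \subset Y b, forall x, x \in A -> Z \subset nbr c b x & M b <= #|Z|%:R].
Proof.
have [n] := ubnP (\sum_b (u b + #|Y b|))%N.
elim: n X Y d u => // n IHn X Y d u; rewrite ltnS => un st.
have [/existsP[b /eqP ub0]|/existsPn un0] := boolP [exists b, u b == 0%N].
  exists b, set0, (Y b); rewrite sub0set cards0 subxx; do 2![split=> //].
  - by move=> x y; rewrite inE.
  - by move=> x; rewrite inE.
  - apply: le_trans (bs_Y st b); rewrite ub0 mul0r sub0r -[leLHS]mulr1 ler_pM2l //.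
    rewrite -[leLHS]expR0 ler_expR oppr_ge0 mulr_ge0_le0 ?boost_cost_Y_ge0 //.
    exact: (ln_height_le0 b st).
have X0 := book_state_X_gt0 st.
have u0 b : (0 < u b)%N by rewrite lt0n.
have [dl0 dl1] := andP delta_01.
have h0 b : 0 < height b (Y b) (d b) by have := height_ge b st; lra.
have d0 b : (0 < d b)%N.
  have /andP[a0 _] := a_01 b.
  have : 0 < (d b)%:R / #|Y b|%:R :> R by move: (h0 b); rewrite /height; lra.
  by rewrite lt0n; apply: contraTneq => ->; rewrite mul0r ltxx.
pose al b := height b (Y b) (d b) / (2 * t%:R).
have al0 b : 0 < al b by rewrite divr_gt0 // mulr_gt0.
have [x [b [j [X' [Z [[xX X'X X'big] [ZP degZ degZb]]]]]]] :=
  density_step X0 d0 al0 (bs_deg st).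
have ZY e : Z e \subset Y e by apply: subset_trans (ZP e).1 _; exact: subsetIl.
have Zx e : Z e \subset nbr c e x by apply: subset_trans (ZP e).1 _; exact: subsetIr.
have measure e u' : (u' <= u e)%N -> (u' + #|Z e| < u e + #|Y e|)%N ->
    (\sum_b (upd u e u' b + #|upd Y e (Z e) b|) < n)%N.
  move=> u'u lt; apply: leq_trans un; rewrite (bigD1 e) //= [X in (_ < X)%N](bigD1 e) //=.
  rewrite !upd_same -addSn leq_add // leq_sum // => b' /negPf be.
  by rewrite /upd be.
have [Jj|jJ] := leqP J j.
  have [dY [d' st']] := boost_step st Jj X'X X'big (ZY b) (ZP b).2 degZb.
  have [|b' [A [Zf [[AX Ac mA] [ZfY AZf Mf]]]]] := IHn _ _ _ _ _ st'.
    by apply: measure => //; rewrite ltn_add2l (ZP b).2.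
  exists b', A, Zf; split; split=> //.
  - exact: subset_trans X'X.
  - by move: Ac; rewrite /upd; case: eqP => // ->.
  - by apply: subset_trans ZfY _; rewrite /upd; case: eqP => // ->.
have X'3 : (3 <= #|X'|)%N.
  rewrite -(ler_nat R); apply: le_trans X'big.
  have big : expR (7 * J%:R + 2) <= #|X|%:R :> R.
    apply: le_trans (bs_X st); rewrite ler_expR; apply: le_trans step_cost_X_ge _.
    have uu : 1 <= (u true + u false)%:R :> R by rewrite ler1n addn_gt0 u0.
    have cX0 : 0 <= step_cost_X by apply: le_trans step_cost_X_ge; rewrite addr_ge0 ?mulr_ge0.
    have l1 := ln_height_le0 true st; have l2 := ln_height_le0 false st.
    have := ler_wpM2r cX0 uu; rewrite mul1r.
    have : 0 <= boost_cost_X * - (ln (height true (Y true) (d true)) +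
        ln (height false (Y false) (d false))).
      by apply: mulr_ge0; [exact: ltW boost_cost_X_gt0 | lra].
    by lra.
  have b0 := overlap_const_gt0 R.
  apply: le_trans (ler_wpM2l _ big); last by rewrite mulr_ge0 ?expR_ge0 // ltW.
  rewrite -[overlap_const R]lnK ?posrE // -!expRD.
  apply: le_trans (expR_ge1Dx _).
  have : j%:R <= J%:R :> R by rewrite ler_nat ltnW.
  by move: J_overlap; lra.
have [e X''big] := large_nbr x X'3.
have [d' st'] := colour_step st (u0 e) (ltnW jJ) X'X X'big X''big (ZY e) (ZP e).2 (degZ e).
have [|b' [A [Zf [[AX Ac mA] [ZfY AZf Mf]]]]] := IHn _ _ _ _ _ st'.
  apply: measure; first exact: leq_pred.
  by rewrite -addSn prednK // leq_add2l subset_leq_card.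
have AX' : A \subset X by apply: subset_trans AX _; apply: subset_trans X'X; exact: subsetIl.
have [b'e|b'e] := eqVneq b' e; last first.
  exists b', A, Zf; split; split=> //.
  - by move: Ac; rewrite /upd (negPf b'e).
  - by move: ZfY; rewrite /upd (negPf b'e).
subst b'; move: Ac ZfY; rewrite !upd_same => Ac ZfY.
have Ax : A \subset nbr c e x by apply: subset_trans AX _; exact: subsetIr.
have xA : x \notin A by apply/negP => /(subsetP Ax); rewrite inE eqxx.
exists e, (x |: A), Zf; split; split=> //.
- by rewrite subUset sub1set xX.
- by rewrite cardsU1 xA Ac add1n prednK.
- apply: monochromaticU => //; first by move=> y z /set1P-> /set1P->; rewrite eqxx.
  by move=> y /set1P->.
- exact: subset_trans (ZY e).
- by move=> y /setU1P[->|/AZf//]; exact: subset_trans (Zx e).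
Qed.

End Book.

(** * Comparing binomial coefficients *)

(** The quotient of the binomials is the product of the factors (n - i) / (n + l - i),
    and each is at most p * (1 - q * i / n) with p = n / (n + l) and
    q = 1 - p.  The second-order terms give the exponential gain over p ^+ t. *)
Lemma bin_ratio_exp (R : realType) (n l t : nat) : (0 < n)%N -> (t <= n)%N ->
  'C(n - t + l, l)%:R <= (n%:R / (n + l)%:R) ^+ t *
    expR (- (l%:R / (n + l)%:R * (t%:R * (t%:R - 1)) / (2 * n%:R))) * 'C(n + l, l)%:R :> R.
Proof.
move=> n0; have nR : 0 < n%:R :> R by rewrite ltr0n.
have S0 : 0 < (n + l)%:R :> R by rewrite natrD ltr_wpDr.
set p : R := n%:R / (n + l)%:R; set q : R := l%:R / (n + l)%:R.
have p0 : 0 < p by rewrite divr_gt0.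
elim: t => [_|t IH tn]; first by rewrite subn0 expr0 !mul0r mulr0 mul0r oppr0 expR0 !mul1r.
have {}IH := IH (ltnW tn).
have B : (n - t + l)%:R * 'C(n - t.+1 + l, l)%:R = (n - t)%:R * 'C(n - t + l, l)%:R :> R.
  have -> : (n - t.+1 + l = (n - t + l).-1)%N by rewrite -(subnSK tn) addSn.
  by rewrite -!natrM mul_bin_down addnK.
have D0 : 0 < (n - t + l)%:R :> R by rewrite ltr0n addn_gt0 subn_gt0 tn.
rewrite -(ler_pM2l D0) B.
apply: le_trans (ler_wpM2l (ler0n _ _) IH) _.
set E := expR _; have -> : expR (- (q * (t.+1%:R * (t.+1%:R - 1)) / (2 * n%:R))) =
    E * expR (- (q * t%:R / n%:R)).
  by rewrite -expRD -natr1; congr expR; field; rewrite gt_eqF.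
have E0 : 0 < E by exact: expR_gt0.
suff core : (n - t)%:R <= (n - t + l)%:R * p * expR (- (q * t%:R / n%:R)).
  apply: le_trans (ler_wpM2r (_ : 0 <= p ^+ t * E * 'C(n + l, l)%:R) core) _.
    by rewrite !mulr_ge0 ?exprn_ge0 // ltW.
  by rewrite exprSr le_eqVlt; apply/orP; left; apply/eqP; ring.
apply: le_trans (_ : (n - t + l)%:R * p * (1 - q * t%:R / n%:R) <= _); last first.
  apply: ler_wpM2l; first by rewrite mulr_ge0 // ltW.
  by apply: le_trans (expR_ge1Dx _); lra.
rewrite natrD natrB; last exact: ltnW.
rewrite -subr_ge0 /p /q natrD.
have nl0 : 0 < n%:R + l%:R :> R by rewrite -natrD.
have -> : (n%:R - t%:R + l%:R) * (n%:R / (n%:R + l%:R)) *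
    (1 - l%:R / (n%:R + l%:R) * t%:R / n%:R) - (n%:R - t%:R) =
    l%:R * (t%:R / (n%:R + l%:R)) ^+ 2 :> R.
  by field; rewrite !gt_eqF.
by rewrite mulr_ge0 ?sqr_ge0.
Qed.

Lemma bin_ge_exp (R : realType) (n l : nat) : (l <= n)%N ->
  expR (l%:R / 2) <= 'C(n + l, l)%:R :> R.
Proof.
move=> ln; have := @ler_bin_ratio R (1 / 2) 0 n l.
rewrite add0n binn natrD => H.
have {}H : 1 <= (1 / 2) ^+ l * 'C(n + l, l)%:R :> R.
  apply: H; first by apply/andP; split; lra.
  have : l%:R <= n%:R :> R by rewrite ler_nat.
  by lra.
have e2 : expR (1 / 2) <= 2 :> R.
  rewrite -[leRHS]lnK ?posrE // ler_expR.
  by apply: le_trans (ln1D_ge_half _) _; [lra | rewrite -[1 + 1]/2].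
have -> : l%:R / 2 = 1 / 2 * l%:R :> R by lra.
rewrite expRM_natr; apply: le_trans (_ : 2 ^+ l <= _).
  by apply: lerXn2r; rewrite ?nnegrE ?expR_ge0.
by move: H; rewrite mul1r exprVn ler_pdivlMl ?exprn_gt0 // mulr1.
Qed.

(** * Books against the inductive bound near the diagonal *)

Section NearDiagonal.
Variables (R : realType) (g : R) (N : nat).
Hypothesis g01 : 0 < g <= 1 / 4.
Hypothesis N_gt : (2688 <= N)%N.
Hypothesis N_g : 484 * 960 <= g ^+ 3 * N%:R.
Hypothesis N_overlap : - ln (overlap_const R) <= N%:R.

(** Exponent gained per unit of the smaller clique size.  It is of order N ^ (- 4):
    a book has about m / N ^ 2 vertices, each of which gains about N ^ (- 2). *)
Definition decay_rate : R := g ^+ 2 / (960 * (120 * N%:R ^+ 4)).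

Let w : R := N%:R^-1.

Lemma N_ge : 2688 <= N%:R :> R.
Proof. by rewrite -[2688]/(2688%:R) ler_nat. Qed.

Lemma invN_bounds : [/\ 0 < w, w <= 1 & 484 * 960 * w <= g ^+ 3].
Proof.
have Nge := N_ge; have N0 : 0 < N%:R :> R by lra.
split; first by rewrite invr_gt0.
  by rewrite /w -[leRHS]invr1 lef_pV2 ?posrE //; lra.
by rewrite ler_pdivrMr.
Qed.

Lemma decay_rateE : decay_rate = g ^+ 2 * w ^+ 4 / (960 * 120).
Proof.
have N0 : 0 < N%:R :> R by have := N_ge; lra.
by rewrite /decay_rate /w; field; rewrite gt_eqF.
Qed.

Lemma g3_le : g ^+ 3 <= g / 16.
Proof.
have [g0 g1] := andP g01.
have : 0 <= g * (1 / 4 - g) * (1 / 4 + g) by rewrite !mulr_ge0 //; lra.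
by lra.
Qed.

(** With w = 1 / N: the terms with logarithms are the total loss in the size of
    [Y b], about 484 w ^ 3 / g per clique vertex (the floor [a] lies 2 w ^ 4 below
    the density, and [H] bounds the logarithm of the initial height).  The quotient
    is the gain of [bin_ratio_exp], about g ^ 2 w ^ 2 / 480 per clique vertex.  For N
    large half of the gain covers the loss, and the other half is what remains. *)
Lemma gain_beats_loss (nb lb t : nat) (m H : R) :
  let p : R := nb%:R / (nb + lb)%:R in let a := p - 2 * w ^+ 4 in
  (0 < nb)%N -> (0 < lb)%N -> (2 <= t)%N ->
  g * (nb + lb)%:R <= nb%:R -> g * (nb + lb)%:R <= lb%:R -> g * (nb + lb)%:R <= m ->
  m * w ^+ 2 <= 120 * t%:R -> 0 <= H <= 4 * N%:R ->
  t%:R * ln p + t%:R * (- ln a) * (1 + 48 * (1 + H) * w ^+ 4)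
    - lb%:R / (nb + lb)%:R * (t%:R * (t%:R - 1)) / (2 * nb%:R) <= - (decay_rate * m).
Proof.
move=> p a nb0 lb0 t2 gn gl gm mt /andP[H0 HN].
have [w0 w1 wg] := invN_bounds; have [g0 g1] := andP g01; have g3 := g3_le.
have rateE := decay_rateE; have N0 : 0 < N%:R :> R by apply: lt_le_trans N_ge; rewrite ltr0n.
have wg16 : w <= g / 16 by lra.
have wk k : 0 <= w ^+ k by rewrite exprn_ge0 // ltW.
pose loss : R := 484 * w ^+ 3 / g.
have L2 : loss <= g ^+ 2 * w ^+ 2 / 960.
  by rewrite /loss ler_pdivrMr //; have := ler_wpM2l (wk 2%N) wg; lra.
clear wg g3 N_g N_gt.
have nR : 0 < nb%:R :> R by rewrite ltr0n.
have lR : 0 < lb%:R :> R by rewrite ltr0n.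
have tR : 2 <= t%:R :> R by rewrite -[2]/(2%:R) ler_nat.
have S0 : 0 < (nb + lb)%:R :> R by rewrite ltr0n addn_gt0 nb0.
have wN : w * N%:R = 1 by rewrite mulVf // gt_eqF.
have pg : g <= p by rewrite ler_pdivlMr.
have wkS k : w ^+ k.+1 <= w ^+ k by rewrite exprS; apply: ler_piMl.
have w4w : w ^+ 4 <= w.
  by have := wkS 1%N; have := wkS 2%N; have := wkS 3%N; rewrite expr1; lra.
have ag : g / 2 <= a by rewrite /a; lra.
have a0 : 0 < a by lra.
have aV : a^-1 <= 2 / g.
  have -> : 2 / g = (g / 2)^-1 by field; rewrite gt_eqF.
  by rewrite lef_pV2 ?posrE //; lra.
have A1 : - ln a <= 2 / g.
  apply: le_trans aV; rewrite -lnV ?posrE //; apply/ltW/ln_sublinear.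
  by rewrite invr_gt0.
have A2 : ln p - ln a <= 4 * w ^+ 4 / g.
  rewrite -ln_div ?posrE //; last by rewrite divr_gt0.
  have -> : p / a = 1 + 2 * w ^+ 4 * a^-1 by rewrite /a; field; rewrite gt_eqF.
  apply: le_trans (le_ln1Dx _) _.
    have : 0 <= 2 * w ^+ 4 * a^-1 by rewrite !mulr_ge0 ?wk ?invr_ge0 ?ler0n // (ltW a0).
    by lra.
  apply: le_trans (ler_wpM2l (_ : 0 <= 2 * w ^+ 4) aV) _; first by rewrite mulr_ge0 ?wk.
  by rewrite le_eqVlt; apply/orP; left; apply/eqP; field; rewrite gt_eqF.
have L1 : ln p + (- ln a) * (1 + 48 * (1 + H) * w ^+ 4) <= loss.
  have B1 : 48 * (1 + H) * w ^+ 4 <= 48 * w ^+ 3 + 192 * w ^+ 3.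
    have -> : 192 * w ^+ 3 = 48 * (4 * N%:R) * w ^+ 4.
      have -> : 48 * (4 * N%:R) * w ^+ 4 = 192 * w ^+ 3 * (w * N%:R) by ring.
      by rewrite wN mulr1.
    have := wkS 3%N.
    have := ler_wpM2r (wk 4%N) HN.
    by lra.
  have B0 : 0 <= 48 * (1 + H) * w ^+ 4.
    by rewrite mulr_ge0 ?wk // mulr_ge0 ?ler0n // addr_ge0.
  have B2 : (- ln a) * (48 * (1 + H) * w ^+ 4) <= 2 / g * (240 * w ^+ 3).
    apply: le_trans (ler_wpM2r B0 A1) _; apply: ler_wpM2l; last by lra.
    by rewrite divr_ge0 // ltW.
  have B3 : 4 * w ^+ 4 / g <= 4 * w ^+ 3 / g.
    by rewrite ler_pM2r ?invr_gt0 // ler_pM2l // wkS.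
  have -> : loss = 4 * w ^+ 3 / g + 2 / g * (240 * w ^+ 3).
    by rewrite /loss; field; rewrite gt_eqF.
  by lra.
have L3 : decay_rate * m <= t%:R * (g ^+ 2 * w ^+ 2 / 960).
  by rewrite rateE; have := ler_wpM2l (mulr_ge0 (sqr_ge0 g) (wk 2%N)) mt; lra.
have L4 : t%:R * (g ^+ 2 * w ^+ 2 / 480) <=
    lb%:R / (nb + lb)%:R * (t%:R * (t%:R - 1)) / (2 * nb%:R).
  have n2 : 0 < 2 * nb%:R :> R by rewrite mulr_gt0.
  rewrite ler_pdivlMr //.
  have q0 : g <= lb%:R / (nb + lb)%:R by rewrite ler_pdivlMr.
  apply: le_trans (_ : g * (t%:R * (t%:R / 2)) <= _); last first.
    apply: ler_pM; [exact: ltW | by rewrite !mulr_ge0 ?invr_ge0 ?ler0n | exact: q0 |].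
    by apply: ler_wpM2l; [exact: ler0n | lra].
  have nS : nb%:R <= (nb + lb)%:R :> R by rewrite ler_nat leq_addr.
  have : 0 <= g * t%:R * (120 * t%:R - g * nb%:R * w ^+ 2).
    rewrite mulr_ge0 ?mulr_ge0 ?(ltW g0) ?ler0n // subr_ge0; apply: le_trans mt.
    apply: ler_wpM2r => //; apply: le_trans gm; apply: ler_wpM2l => //; exact: ltW.
  by lra.
have t0 : 0 <= t%:R :> R by [].
have := ler_wpM2l t0 (le_trans L1 L2).
by move: L3 L4; lra.
Qed.


Lemma invN4_le : w ^+ 4 <= g / 4.
Proof.
have [w0 w1 wg] := invN_bounds; have [g0 g1] := andP g01; have g3 := g3_le.
have : w ^+ 4 <= w by rewrite exprS ler_piMr ?exprn_ile1 // ltW.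
by lra.
Qed.

Lemma decay_rate_bounds : 0 < decay_rate /\ decay_rate <= w ^+ 4 / 4.
Proof.
have [w0 w1 wg] := invN_bounds; have [g0 g1] := andP g01.
have w4 : 0 < w ^+ 4 by rewrite exprn_gt0.
rewrite decay_rateE; split; first by rewrite divr_gt0 ?mulr_gt0 ?exprn_gt0 ?ltr0n.
have : g ^+ 2 <= 1 by rewrite expr2; apply: mulr_ile1; lra.
move=> /(ler_wpM2r (ltW w4)); lra.
Qed.

Lemma bin_colour (s : bool -> nat) b :
  'C(s b + s (~~ b), s (~~ b)) = 'C(s true + s false, s false).
Proof.
case: b => //=; rewrite addnC -bin_sub ?leq_addr //; congr binomial.
by rewrite addKn.
Qed.

(** All parameters of the book are chosen here: threshold J = N ^ 2, initial height
    N ^ (- 4), and t about m / (60 N ^ 2), which keeps the cost 15 t N ^ 2 of the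
    reservoir below m / 4. *)
Lemma near_diagonal_contra (T : finType) (c : T -> T -> bool) (s : bool -> nat)
    (V : {set T}) (m : nat) : symmetric c -> cliquefree c s V ->
  m = minn (s true) (s false) -> (60 * N ^ 10 <= m)%N ->
  g * (s true + s false)%:R <= m%:R ->
  (forall b x, x \in V -> ((s b)%:R / (s true + s false)%:R - 2 * decay_rate) * #|V|%:R - 1 <=
     #|V :&: nbr c b x|%:R) ->
  expR (- (decay_rate * m%:R)) * 'C(s true + s false, s false)%:R <= #|V|%:R -> False.
Proof.
move=> csym sV mE m_big gm deg Vbig.
have [w0 w1 wg] := invN_bounds; have [g0 g1] := andP g01.
have w4 := invN4_le.
have gain := gain_beats_loss.
have N_ge' := N_ge.
have [e0 e1] := decay_rate_bounds.
have N0 : 0 < N%:R :> R by apply: lt_le_trans N_ge'; rewrite ltr0n.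
have w2688 : 2688 * w <= 1.
  by rewrite ler_pdivrMr // mul1r.
have N6 : (6 <= N)%N by exact: leq_trans N_gt.
clear wg N_g N_ge' N_gt.
have NN0 : (0 < N)%N by rewrite -(ltr0n R).
have wN : w * N%:R = 1 by rewrite mulVf // gt_eqF.
have wNk k : w ^+ k * N%:R ^+ k = 1 by rewrite -exprMn wN expr1n.
have w4_gt0 : 0 < w ^+ 4 by rewrite exprn_gt0.
pose t := (m %/ (60 * N ^ 2))%N.
have D0 : (0 < 60 * N ^ 2)%N by rewrite muln_gt0 expn_gt0 NN0.
have tm : (t * (60 * N ^ 2) <= m)%N by exact: leq_divM.
have tN : (N ^ 8 <= t)%N by rewrite leq_divRL // mulnCA -expnD.
have mt : (m < t.+1 * (60 * N ^ 2))%N by exact: ltn_ceil.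
have N8 : (2 <= N ^ 8)%N.
  have N2 : (2 <= N)%N by exact: leq_trans N6.
  by apply: leq_trans N2 _; rewrite -{1}(expn1 N) leq_pexp2l.
have t2 : (2 <= t)%N by exact: leq_trans tN.
have tR : 2 <= t%:R :> R by rewrite -[2]/(2%:R) ler_nat.
have tmR : t%:R * (60 * N%:R ^+ 2) <= m%:R :> R.
  by rewrite -natrX -[60]/(60%:R) -!natrM ler_nat.
have mtR : m%:R <= 120 * t%:R * N%:R ^+ 2 :> R.
  have : m%:R <= (t%:R + 1) * (60 * N%:R ^+ 2) :> R.
    by rewrite natr1 -natrX -[60]/(60%:R) -!natrM ler_nat ltnW.
  have := ler_wpM2r (sqr_ge0 (N%:R : R)) tR; lra.
have tNR : N%:R ^+ 8 <= t%:R :> R by rewrite -natrX ler_nat.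
have {}tNR : N%:R ^+ 4 <= w ^+ 4 * t%:R.
  have := ler_wpM2l (ltW w4_gt0) tNR.
  by rewrite -[8%N]/(4 + 4)%N exprD mulrA wNk mul1r.
have n_lb : expR (m%:R / 4) <= #|V|%:R :> R.
  apply: le_trans Vbig; apply: le_trans (_ : expR (- (decay_rate * m%:R)) * expR (m%:R / 2) <= _).
    rewrite -expRD ler_expR.
    have e14 : decay_rate <= 1 / 4 by lra.
    by have := ler_wpM2r (ler0n R m) e14; lra.
  apply: ler_wpM2l; first exact: expR_ge0.
  rewrite mE; have [sm|sm] := leqP (s true) (s false).
    by rewrite -(bin_colour s false); exact: bin_ge_exp.
  by rewrite -(bin_colour s true); exact: bin_ge_exp (ltnW _).
have n0 : 0 < #|V|%:R :> R by apply: lt_le_trans n_lb; exact: expR_gt0.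
have V0 : V != set0 by rewrite -card_gt0 -(ltr0n R).
have ms b : (m <= s b)%N by rewrite mE; case: b; rewrite ?geq_minl ?geq_minr.
have m2 : (2 <= m)%N.
  apply: leq_trans t2 _; apply: leq_trans tm; exact: leq_pmulr.
have s0 b : (0 < s b)%N by apply: leq_trans (ms b); exact: ltnW.
pose S : R := (s true + s false)%:R.
have SE b : S = (s b + s (~~ b))%:R by rewrite /S; case: b; rewrite //= addnC.
have S0 : 0 < S by rewrite ltr0n addn_gt0 s0.
pose p b : R := (s b)%:R / S.
have gs b : g * S <= (s b)%:R by apply: le_trans gm _; rewrite ler_nat.
have p_ge b : g <= p b by rewrite ler_pdivlMr.
have p_le b : p b <= 1.
  by rewrite ler_pdivrMr // mul1r (SE b) ler_nat leq_addr.
(* The degrees are known up to a relative error below w ^ 4, which leaves an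
   initial height of at least w ^ 4. *)
pose a b := p b - 2 * w ^+ 4.
have a01 b : 0 < a b <= 1.
  rewrite /a; have := p_ge b; have := p_le b => pl pg.
  by apply/andP; split; lra.
pose M b : R := 'C(s b - t + s (~~ b), s (~~ b))%:R.
have M0 b : 0 < M b by rewrite ltr0n bin_gt0 leq_addl.
have tmN : (t <= m)%N by apply: leq_trans tm; exact: leq_pmulr.
have ninv : #|V|%:R^-1 <= w ^+ 4 / 2.
  have n4 : 2 * N%:R ^+ 4 <= #|V|%:R :> R.
    apply: le_trans n_lb; apply: le_trans (_ : m%:R / 4 <= _); last first.
      by apply: le_trans (expR_ge1Dx _); lra.
    have : w ^+ 4 * t%:R <= t%:R by apply: ler_piMl => //; lra.
    have : 1 <= N%:R ^+ 2 :> R by rewrite -natrX ler1n expn_gt0 NN0.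
    move=> /(ler_wpM2l (ler0n R t)) H1 H2; lra.
  have w4E : w ^+ 4 = (N%:R ^+ 4)^-1 by rewrite exprVn.
  have -> : w ^+ 4 / 2 = (2 * N%:R ^+ 4)^-1 by rewrite invfM mulrC w4E.
  by rewrite lef_pV2 // posrE mulr_gt0 // exprn_gt0.
have [d dP] : exists d : bool -> nat, forall b,
    (p b - 2 * decay_rate) * #|V|%:R - 1 <= (d b)%:R /\
    (forall x, x \in V -> (d b <= #|V :&: nbr c b x|)%N).
  have ex b : exists d : nat, (p b - 2 * decay_rate) * #|V|%:R - 1 <= d%:R /\
      (forall x, x \in V -> (d <= #|V :&: nbr c b x|)%N).
    by have [d d1 d2] := min_value V0 (deg b); exists d.
  have [d1 dP1] := ex true; have [d2 dP2] := ex false.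
  by exists (fun b => if b then d1 else d2) => -[].
have hgt b : w ^+ 4 <= height a b V (d b).
  rewrite /height /a lerBrDr ler_pdivlMr //; apply: le_trans (dP b).1.
  have := ler_wpM2r (ltW n0) ninv; rewrite mulVf ?gt_eqF // => H1.
  have H2 : 2 * decay_rate * #|V|%:R <= w ^+ 4 / 2 * #|V|%:R.
    by rewrite ler_pM2r //; lra.
  by lra.
have hgt1 b : height a b V (d b) <= 1.
  have dV : (d b <= #|V|)%N.
    have /set0Pn[x xV] := V0; apply: leq_trans ((dP b).2 x xV) _.
    by rewrite subset_leq_card // subsetIl.
  have H1 := height_le a b dV; have /andP[H2 _] := a01 b.
  by lra.
pose H b := - ln (height a b V (d b)).
have HN b : 0 <= H b <= 4 * N%:R.
  rewrite /H oppr_ge0 ln_le0 //=; apply: le_trans (_ : - ln (w ^+ 4) <= _).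
    by rewrite lerN2 ler_ln ?posrE // (lt_le_trans w4_gt0).
  rewrite exprVn lnV ?posrE ?exprn_gt0 // opprK lnXn //.
  by rewrite -[_ *+ 4]mulr_natl ler_wpM2l ?ler0n // ltW // ln_sublinear.
have N_sq : (N ^ 2)%N%:R = N%:R ^+ 2 :> R by rewrite natrX.
have bs : book_state c t (N ^ 2) (w ^+ 4) a M V (fun=> V) d (fun=> t).
  split=> //.
  - by move=> b; exact: (dP b).2.
  - move=> b; apply: le_trans (hgt b); rewrite addnn -mul2n natrM mulfK //.
    by rewrite mulf_neq0 // pnatr_eq0 // -lt0n ltnW.
  - apply: le_trans n_lb; rewrite ler_expR /step_cost_X /boost_cost_X N_sq.
    have w2 : (N%:R ^+ 2)^-1 = w ^+ 2 :> R by rewrite exprVn.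
    rewrite w2 natrD; have [H1 H2] := andP (HN true); have [H3 H4] := andP (HN false).
    have -> : ln (height a true V (d true)) = - H true by rewrite opprK.
    have -> : ln (height a false V (d false)) = - H false by rewrite opprK.
    have tw0 : 0 <= 336 * t%:R * w ^+ 2 by rewrite !mulr_ge0 ?ler0n ?exprn_ge0 // ltW.
    have wk : 336 * t%:R * w ^+ 2 * (H true + H false) <= t%:R * (2688 * w).
      apply: le_trans (ler_wpM2l tw0 (lerD H2 H4)) _.
      have -> : 336 * t%:R * w ^+ 2 * (4 * N%:R + 4 * N%:R) = t%:R * (2688 * w) * (w * N%:R).
        by ring.
      by rewrite wN mulr1.
    have w2w : w ^+ 2 <= w by rewrite expr2 ler_piMl // ltW.
    have N2 : 6 <= N%:R ^+ 2 :> R.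
      rewrite -[6]/(6%:R) -natrX ler_nat; apply: leq_trans N6 _.
      by rewrite -{1}(expn1 N) leq_pexp2l.
    have t0 : 0 <= t%:R :> R by exact: ler0n.
    have := ler_wpM2l t0 w2688; have := ler_wpM2l t0 w2w; have := ler_wpM2l t0 N2.
    clear - tmR wk t0; set x := N%:R ^+ 2 in tmR *; set y := w ^+ 2 in wk *.
    by lra.
  - move=> b; apply: le_trans Vbig.
    have -> : ln (height a b V (d b)) = - H b by rewrite opprK.
    have lb := bin_ratio_exp R (s (~~ b)) (s0 b) (leq_trans tmN (ms b)).
    rewrite bin_colour in lb.
    have gl := gain _ _ _ m%:R _ (s0 b) (s0 (~~ b)) t2 _ _ _ _ (HN b).
    rewrite -SE -/w in gl lb; move/(_ (gs b) (gs (~~ b)) gm): gl => gl.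
    have {gl} gl := gl _.
    apply: le_trans (ler_wpM2r (expR_ge0 _) lb) _.
    rewrite mulrAC; apply: ler_wpM2r; first exact: ler0n.
    rewrite -/(p b) -[p b]lnK; last by rewrite posrE; apply: lt_le_trans (p_ge b).
    rewrite -expRM_natl -!expRD ler_expR.
    apply: le_trans (gl _).
      rewrite le_eqVlt; apply/orP; left; apply/eqP.
      rewrite /step_cost_Y /boost_cost_Y N_sq -/(a b) -/(p b).
      have -> : w ^+ 4 = (N%:R ^+ 2) ^- 2 by rewrite -exprM exprVn.
      by rewrite -!/(p b); ring.
    have := ler_wpM2r (exprn_ge0 2 (ltW w0)) mtR.
    by rewrite -[leRHS]mulrA [N%:R ^+ 2 * _]mulrC wNk mulr1.
have [b [A [Z [[AV At mA] [ZV AZ MZ]]]]] : exists b (A Z : {set T}),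
    [/\ A \subset V, #|A| = t & monochromatic c b A] /\
    [/\ Z \subset V, forall x, x \in A -> Z \subset nbr c b x & M b <= #|Z|%:R].
  apply: (monochromatic_book csym _ _ _ _ _ a01 M0 bs).
  - exact: ltnW.
  - by apply: leq_trans (leq_trans _ N6) _; rewrite // -{1}(expn1 N) leq_pexp2l.
  - apply: le_trans N_overlap _; rewrite ler_nat -{1}(expn1 N); exact: leq_pexp2l.
  - by rewrite w4_gt0; lra.
  - rewrite N_sq -exprM; have H0 : 0 <= w ^+ 4 * t%:R by rewrite mulr_ge0 // ltW.
    by lra.
have := erdos_szekeres csym (cliquefree_book csym sV AV ZV mA AZ).
rewrite At -(bin_colour _ b) /shrink eqxx.
have -> : (~~ b == b) = false by case: (b).
by rewrite -(ltr_nat R) ltNge MZ.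
Qed.

End NearDiagonal.

(** * The bound near the diagonal *)

(** A function of the clique sizes that is 1-Lipschitz in each of them, vanishes
    where one of them is small or the ratio is unbalanced, and for g = 1 / 250 is
    at least l / 2 - K for l between k / 100 and k. *)
Definition near_diagonal_exponent (R : realType) (g K : R) (s : bool -> nat) : R :=
  Num.max 0 ((minn (s true) (s false))%:R - g * (s true + s false)%:R - K).

Lemma near_diagonal_exponent_shrink (R : realType) (g K : R) s b : 0 <= g ->
  near_diagonal_exponent g K s - 1 <= near_diagonal_exponent g K (shrink s b 1).
Proof.
move=> g0; rewrite /near_diagonal_exponent lerBlDr ge_max; apply/andP; split.
  by rewrite addr_ge0 // le_max lexx.
apply: le_trans (_ : (minn (shrink s b 1 true) (shrink s b 1 false))%:R -
  g * (shrink s b 1 true + shrink s b 1 false)%:R - K + 1 <= _); last first.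
  by rewrite lerD2r le_max lexx orbT.
have H1 : (minn (s true) (s false))%:R <=
    (minn (shrink s b 1 true) (shrink s b 1 false))%:R + 1 :> R.
  by rewrite natr1 ler_nat /shrink; case: (b) => /=; rewrite ?subn1; lia.
have H2 : (shrink s b 1 true + shrink s b 1 false)%:R <= (s true + s false)%:R :> R.
  by rewrite ler_nat /shrink; case: (b) => /=; rewrite ?subn1; lia.
have := ler_wpM2l g0 H2; lra.
Qed.

(** Two thresholds: 2688 = 8 * 336 makes the contribution of the potential to the
    cost of a clique vertex at most 1 in the reservoir, and 484 * 960 makes the gain
    twice the loss in [gain_beats_loss]. *)
Lemma exists_scale (R : realType) (g : R) : 0 < g ->
  exists N : nat, [/\ (2688 <= N)%N, 484 * 960 <= g ^+ 3 * N%:R &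
    - ln (overlap_const R) <= N%:R].
Proof.
move=> g0; exists (2688 + ((Num.truncn (484 * 960 / g ^+ 3)).+1 +
   (Num.truncn (- ln (overlap_const R))).+1))%N; split; first exact: leq_addr.
- rewrite [leRHS]mulrC -ler_pdivrMr ?exprn_gt0 //.
  apply: le_trans (ltW (truncnS_gt (484 * 960 / g ^+ 3))) _.
  by rewrite ler_nat addnCA; exact: leq_addr.
- apply: le_trans (ltW (truncnS_gt (- ln (overlap_const R)))) _.
  rewrite ler_nat addnA; exact: leq_addl.
Qed.

(** Induction on the sum of the clique sizes.  Where the exponent vanishes, this is
    the Erdos-Szekeres bound.  Elsewhere the induction hypothesis for the
    neighbourhoods makes all degrees nearly what the densities s b / S predict, since
    the exponent changes by at most 1, and [near_diagonal_contra] applies. *)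
Lemma near_diagonal (R : realType) (g : R) : 0 < g <= 1 / 4 ->
  exists e K : R, 0 < e /\
    forall (T : finType) (c : T -> T -> bool) (s : bool -> nat) (V : {set T}),
    symmetric c -> cliquefree c s V ->
    #|V|%:R < expR (- (e * near_diagonal_exponent g K s)) *
              'C(s true + s false, s false)%:R.
Proof.
move=> g01; have [g0 g1] := andP g01.
have [N [N1 N2 N3]] := exists_scale g0.
have [e0 e1] := decay_rate_bounds g01 N1 N2.
have e4 : decay_rate g N <= 1 / 4.
  have [w0 w1 _] := invN_bounds N1 N2.
  have : (N%:R^-1 : R) ^+ 4 <= 1 by rewrite exprn_ile1 // ltW.
  by lra.
have contra (T : finType) (c : T -> T -> bool) s V m :=
  @near_diagonal_contra R g N g01 N1 N2 N3 T c s V m.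
exists (decay_rate g N), (60 * N ^ 10)%:R; split=> // T c s V csym.
clear N1 N2 N3 e1; set e := decay_rate g N in e0 e4 contra *; set K := (60 * N ^ 10)%:R.
have K0 : 0 <= K by exact: ler0n.
have leK m : K <= m%:R -> (60 * N ^ 10 <= m)%N by rewrite ler_nat.
clearbody K.
have [n] := ubnP (s true + s false)%N; elim: n s V => // n IHn s V.
rewrite ltnS => sn sV; set C := 'C(_, _); set phi := near_diagonal_exponent g K s.
have ES : #|V|%:R < C%:R :> R by rewrite ltr_nat; exact: erdos_szekeres.
have [phi0|phi0] := lerP phi 0.
  have -> : phi = 0.
    by apply/eqP; rewrite eq_le phi0 /phi /near_diagonal_exponent le_max lexx.
  by rewrite mulr0 oppr0 expR0 mul1r.
have [//|Fn] := ltrP; exfalso; move: Fn; set F := expR _ * _ => Fn.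
set m := minn (s true) (s false).
have phiE : phi = m%:R - g * (s true + s false)%:R - K.
  move: phi0; rewrite /phi /near_diagonal_exponent -/m; case: (lerP 0 _) => //.
  by rewrite ltxx.
have gS0 : 0 <= g * (s true + s false)%:R by rewrite mulr_ge0 // ltW.
have mK : (60 * N ^ 10 <= m)%N by apply: leK; lra.
apply: (contra _ _ _ _ _ csym sV erefl mK).
- by rewrite -/m; lra.
- move=> b x xV; rewrite -/e; set S : R := (s true + s false)%:R.
  have sb0 b' : (0 < s b')%N by exact: (cliquefree_gt0 b' sV xV).
  have S0 : 0 < S by rewrite ltr0n addn_gt0 sb0.
  have SE b' : S = (s b' + s (~~ b'))%:R by rewrite /S; case: b'; rewrite //= addnC.
  have small : (shrink s (~~ b) 1 true + shrink s (~~ b) 1 false < n)%N.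
    apply: leq_trans sn; rewrite /shrink; case: (b) => /=; rewrite subn1.
      by rewrite ltn_add2l ltn_predL.
    by rewrite ltn_add2r ltn_predL.
  have := IHn _ _ small (cliquefree_nbr (b := ~~ b) csym sV xV).
  rewrite -(bin_colour _ (~~ b)); set phi' := near_diagonal_exponent _ _ _.
  rewrite /shrink eqxx negbK.
  have -> : (b == ~~ b) = false by case: (b).
  set B := 'C(_, _) => lt1.
  set p : R := (s (~~ b))%:R / S.
  have p01 : 0 <= p <= 1.
    rewrite divr_ge0 ?ler0n ?(ltW S0) //= ler_pdivrMr // mul1r (SE (~~ b)).
    by rewrite ler_nat leq_addr.
  have Bp : B%:R <= p * C%:R :> R.
    have := bin_ratio_exp R (s b) (sb0 (~~ b)) (sb0 (~~ b)).
    have := bin_colour s (~~ b); have := SE (~~ b); rewrite negbK => <- ->.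
    by rewrite subrr !mulr0 mul0r oppr0 expR0 mulr1 expr1.
  have le2 : #|V :&: nbr c (~~ b) x|%:R <= (p + 2 * e) * #|V|%:R.
    apply/ltW/(lt_le_trans lt1).
    have phi'1 : phi - 1 <= phi' by apply: near_diagonal_exponent_shrink; exact: ltW.
    have E1 : expR (- (e * phi')) <= expR (- (e * phi)) * (1 + 2 * e).
      apply: le_trans (_ : expR (- (e * phi)) * expR e <= _).
        by rewrite -expRD ler_expR; have := ler_wpM2l (ltW e0) phi'1; lra.
      apply: ler_wpM2l; first exact: expR_ge0.
      rewrite -[leLHS]invrK -expRN -[leRHS]invrK lef_pV2 ?posrE ?invr_gt0 ?expR_gt0 //; last lra.
      apply: le_trans (_ : 1 - e <= _); last by apply: le_trans (expR_ge1Dx _); lra.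
      rewrite -[leLHS]mul1r ler_pdivrMr; last lra.
      have : 0 <= e * (1 / 2 - e) by rewrite mulr_ge0 ?ltW //; lra.
      by lra.
    apply: le_trans (ler_pM (expR_ge0 _) (ler0n _ _) E1 Bp) _.
    have [pl pu] := andP p01.
    apply: le_trans (_ : (1 + 2 * e) * p * #|V|%:R <= _).
      have -> : expR (- (e * phi)) * (1 + 2 * e) * (p * C%:R) = (1 + 2 * e) * p * F.
        by rewrite /F; ring.
      apply: ler_wpM2l => //; apply: mulr_ge0 => //; lra.
    apply: ler_wpM2r; first exact: ler0n.
    have := ler_wpM2l (ltW e0) pu; lra.
  have pp : (s b)%:R / S = 1 - p.
    by apply/eqP; rewrite eq_sym subr_eq -mulrDl -natrD -(SE b) divff // gt_eqF.
  have := card_nbr_split c b xV => /(congr1 (fun m => m%:R : R)) /=.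
  by rewrite -natr1 natrD pp; lra.
- apply: le_trans Fn; rewrite -/e /F; apply: ler_wpM2r; first exact: ler0n.
  by rewrite ler_expR lerN2 ler_pM2l // -/m; lra.
Qed.

(** * From cliquefree sets to Ramsey numbers *)

Definition clique_sizes (k l : nat) : bool -> nat := fun b => if b then k else l.

Lemma ramsey_extremal (k l : nat) : (0 < ramsey k l)%N ->
  exists (T : finType) (c : T -> T -> bool) (V : {set T}),
    [/\ symmetric c, cliquefree c (clique_sizes k l) V & ramsey k l = #|V|.+1].
Proof.
move=> r0; set n := (ramsey k l).-1.
have rE : ramsey k l = n.+1 by rewrite prednK.
have : ~~ ramsey_prop k l n.
  apply/negP => rn; move: rE; rewrite /ramsey; case: ex_minnP => m _ /(_ n rn) mn mE.
  by rewrite mE ltnn in mn.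
rewrite negb_forall => /existsP[col]; rewrite negb_or => /andP[noR noB].
pose c (x y : 'I_n) : bool := if insub [set x; y] is Some e then col e else true.
exists 'I_n, c, [set: 'I_n]; split; first by move=> x y; rewrite /c setUC.
  move=> b A _ mA; rewrite ltnNge; apply/negP => sA.
  have [B BA Bs] := card_subset_exists sA.
  have Bm : mono_clique col b (clique_sizes k l b) B.
    rewrite /mono_clique Bs eqxx; apply/forallP => e; apply/implyP => /subsetP eB.
    have /cards2P[x [y [xy eE]]] := valP e.
    have <- : c x y = col e by rewrite /c -eE valK.
    by apply/eqP/mA => //; apply: (subsetP BA); apply: eB; rewrite eE !inE eqxx ?orbT.
  case: (b) Bm => /= Bm.
    by move/existsP: noR; apply; exists B.
  by move/existsP: noB; apply; exists B.
by rewrite cardsT card_ord rE.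
Qed.

Local Open Scope classical_set_scope.
Local Open Scope ring_scope.

Lemma ln_linear_little_o (R : realType) (B : R) : 0 < B ->
  ln (B * k.+1%:R) / k%:R @[k --> \oo] --> (0 : R).
Proof.
move=> B0; apply/cvgrPdist_le => e e0; near=> k.
have kB : 4 * B / e ^+ 2 <= k%:R by near: k; exact: nbhs_infty_ger.
have kB2 : B^-1 <= k%:R by near: k; exact: nbhs_infty_ger.
have k0 : 0 < k%:R :> R by apply: lt_le_trans kB2; rewrite invr_gt0.
have k1 : 1 <= k%:R :> R by rewrite ler1n -(ltr0n R).
have Bk0 : 0 < B * k.+1%:R by rewrite mulr_gt0 // ltr0n.
have Bk1 : 1 <= B * k.+1%:R.
  have := ler_wpM2l (ltW B0) kB2; rewrite divff ?gt_eqF // => H.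
  by apply: le_trans H _; rewrite ler_pM2l // ler_nat.
rewrite sub0r normrN ger0_norm; last by rewrite divr_ge0 ?ln_ge0 // ltW.
rewrite ler_pdivrMr // -ler_expR lnK ?posrE //.
have ek0 : 0 <= e * k%:R by rewrite mulr_ge0 // ltW.
apply: le_trans (expR_ge1Dxn 1 ek0).
have -> : 2`!%:R = 2 :> R by [].
have : 4 * B <= e ^+ 2 * k%:R.
  by move: kB; rewrite ler_pdivrMr ?exprn_gt0 // [leRHS]mulrC.
move=> /(ler_wpM2r (ltW k0)) H.
have : B * k.+1%:R <= 2 * (B * k%:R).
  by rewrite -natr1; have := ler_wpM2l (ltW B0) k1; lra.
rewrite exprMn; lra.
Unshelve. all: by end_near.
Qed.

Theorem theorem1p2 (R : realType) :
  exists delta : R, 0 < delta /\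
  exists f : nat -> R,
    (f k / k%:R @[k --> \oo] --> (0 : R)) /\
    forall k l : nat, (l <= k)%N ->
      (ramsey k l)%:R <= expR (- delta * l%:R + f k) * 'C(k + l, l)%:R.
Proof.
have g01 : 0 < (1 / 250 : R) <= 1 / 4 by apply/andP; split; lra.
have [e [K [e0 near]]] := near_diagonal g01.
pose dA : R := - ln (99 / 100).
have dA0 : 0 < dA by rewrite oppr_gt0; apply: ln_lt0; apply/andP; split; lra.
pose delta := Num.min (1 / 2) (Num.min dA (e / 2)).
have d0 : 0 < delta by rewrite !lt_min dA0 divr_gt0 //=; lra.
have d12 : delta <= 1 / 2 by rewrite ge_min lexx.
have ddA : delta <= dA by rewrite /delta !ge_min lexx orbT.
have de : delta <= e / 2 by rewrite /delta !ge_min lexx !orbT.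
pose B : R := 201 + expR (e * K).
have B0 : 0 < B by rewrite addr_gt0 ?ltr0n ?expR_gt0.
exists delta; split=> //; exists (fun k => ln (B * k.+1%:R)); split.
  exact: ln_linear_little_o.
move=> k l lk; rewrite expRD lnK ?posrE ?mulr_gt0 ?ltr0n // mulNr.
set C : R := 'C(k + l, l)%:R; set D := expR (- (delta * l%:R)).
have D0 : 0 < D by exact: expR_gt0.
have C0 : 0 < C by rewrite ltr0n bin_gt0 leq_addl.
have [->|r0] := posnP (ramsey k l).
  by rewrite !mulr_ge0 ?ler0n ?ltW.
have [T [c [V [csym sV ->]]]] := ramsey_extremal r0.
have DC1 : 1 <= D * C.
  apply: le_trans (_ : D * expR (l%:R / 2) <= _); last first.
    by apply: ler_wpM2l; [exact: ltW | exact: bin_ge_exp].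
  rewrite -expRD -[leLHS]expR0 ler_expR.
  by have := ler_wpM2r (ler0n R l) d12; lra.
have DC0 : 0 < D * C by rewrite mulr_gt0.
have k1 : 1 <= k.+1%:R :> R by rewrite ler1n.
have lR : l%:R <= k%:R :> R by rewrite ler_nat.
have l0 : 0 <= l%:R :> R by [].
(* The summand 1 accounts for the difference between the Ramsey number and the
   size of an extremal colouring; it is absorbed because 1 <= D * C. *)
suff [F [FB VF]] : exists F : R, F + 1 <= B * k.+1%:R /\ #|V|%:R <= F * (D * C).
  rewrite -natr1; apply: le_trans (_ : (F + 1) * (D * C) <= _); first by lra.
  by have := ler_wpM2r (ltW DC0) FB; lra.
have eK0 := expR_gt0 (e * K).
have [far|close] := leqP (100 * l) k.
  exists (200 * k.+1%:R); split.
    by have := ler_wpM2l (ltW eK0) k1; rewrite /B; lra.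
  have := off_diagonal R csym far sV; rewrite /clique_sizes /= -/C => /ltW /le_trans; apply.
  rewrite mulrA; apply: ler_wpM2r; first exact: ltW.
  apply: ler_pM.
  - by rewrite mulr_ge0 ?ler0n.
  - by apply: exprn_ge0; lra.
  - by rewrite -(natr1 (k + l)) -(natr1 k) natrD; clear - lR; lra.
  - have -> : 99 / 100 = expR (- dA) :> R by rewrite opprK lnK // posrE; lra.
    by rewrite -expRM_natr ler_expR mulNr lerN2; exact: ler_wpM2r.
exists (expR (e * K)); split.
  have : expR (e * K) <= expR (e * K) * k.+1%:R by rewrite ler_peMr // ltW.
  by rewrite /B; lra.
have := near _ _ _ _ csym sV; rewrite /clique_sizes /= -/C => /ltW /le_trans; apply.
rewrite mulrA -expRD; apply: ler_wpM2r; first exact: ltW.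
rewrite ler_expR.
set phi := near_diagonal_exponent _ _ _.
have philb : l%:R / 2 - K <= phi.
  rewrite /phi /near_diagonal_exponent le_max; apply/orP; right.
  rewrite /= (minn_idPr lk) natrD.
  have : k%:R <= 100 * l%:R :> R by rewrite -[100]/(100%:R) -natrM ler_nat ltnW.
  by lra.
have := ler_wpM2l (ltW e0) philb.
have := ler_wpM2r l0 de.
by lra.
Qed.
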